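(* Let $d\ge 2$, $2<p\le\infty$, and $1/p<r<1/2$. Then there is a constant $C$, independent of $m$ (it may depend on $d,p,r$), such that for all integers $m\ge 2$ $$er_m(\mathbf H^r_p,L_2)\le C\,m^{-r}(\log m)^{d-1+r}.$$
   Context: $\mathbb T^d=[0,2\pi)^d$ is the $d$-dimensional torus with normalized Lebesgue measure $\mu=(2\pi)^{-d}d\mathbf x$; functions are real, $2\pi$-periodic in each variable, and $L_p$ norms are with respect to $\mu$. Let $\Delta^l_{t,j}$ denote the $l$-th difference operator with step $t$ in the variable $x_j$. For $\mathbf t=(t_1,\dots,t_d)\in\mathbb R^d$ and $e\subset\{1,\dots,d\}$ put $\Delta^l_{\mathbf t}(e):=\prod_{j\in e}\Delta^l_{t_j,j}$, with $\Delta^l_{\mathbf t}(\varnothing)$ the identity. With $l:=[r]+1$, the class $\mathbf H^r_p$ is the set of $f\in L_p(\mathbb T^d)$ such that for every $e\subset\{1,\dots,d\}$ and every $\mathbf t$ $$\|\Delta^l_{\mathbf t}(e)f\|_p\le\prod_{j\in e}|t_j|^r.$$ For $r>1/p$ these functions are continuous (continuous representatives are taken). The optimal error of sampling discretization of the square norm for a class $W$ of continuous functions is $$er_m(W,L_2):=\inf_{\xi^1,\dots,\xi^m\in\mathbb T^d}\ \sup_{f\in W}\Big|\|f\|_2^2-\frac1m\sum_{j=1}^m|f(\xi^j)|^2\Big|.$$ *)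

(* Defs.v *)
From HB Require Import structures.
From mathcomp Require Import all_boot all_order all_algebra.
From mathcomp Require Import all_classical all_reals all_analysis.
Import Order.TTheory GRing.Theory Num.Theory.
Import numFieldNormedType.Exports.

Set Implicit Arguments.
Unset Strict Implicit.
Unset Printing Implicit Defensive.

Local Open Scope classical_set_scope.
Local Open Scope ring_scope.

(* Points of R^d are row vectors, which carry the topology. Mathcomp-analysis
   puts the product sigma-algebra on tuples, so measures live there and
   [row_of_tuple] is the change of representation. *)
Section torus_measure.
Context {R : realType}.
Local Notation RB := (measurableTypeR R).

Lemma two_pi_gt0 : (0 : R) < 2 * pi.
Proof. by rewrite mulr_gt0// pi_gt0. Qed.

(* [uniform_prob a b] has density (b - a)^-1 on the closed interval [a, b];
   the endpoint 2 pi is negligible. *)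
Definition circle_measure : probability RB R :=
  uniform_prob two_pi_gt0.

Definition tuple_cons n (z : RB * n.-tuple RB) : n.+1.-tuple RB :=
  [tuple of z.1 :: z.2].

Lemma measurable_tuple_cons n :
  measurable_fun [set: RB * n.-tuple RB] (@tuple_cons n).
Proof. exact: (measurable_cons measurable_fst measurable_snd). Qed.

HB.instance Definition _ n :=
  isMeasurableFun.Build _ _ _ _ (@tuple_cons n) (@measurable_tuple_cons n).

(* The normalized Lebesgue measure (2 pi)^-d dx on [0, 2 pi)^d: the d-fold
   product of [circle_measure], transported along R * R^n = R^(n+1). *)
Fixpoint torus_measure (d : nat) : probability (d.-tuple RB) R :=
  match d with
  | 0 => \d_([tuple] : 0.-tuple RB)
  | n.+1 => distribution (circle_measure \x torus_measure n)%E (@tuple_cons n)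
  end.

End torus_measure.

Section classes.
Context {R : realType} {d : nat}.
Local Notation RB := (measurableTypeR R).
Implicit Types (f : 'rV[R]_d -> R) (p : \bar R) (r t : R).

Definition row_of_tuple (x : d.-tuple RB) : 'rV[R]_d := \row_i tnth x i.

Definition torus : set 'rV[R]_d :=
  [set x | forall j, 0 <= x ord0 j < 2 * pi].

Definition torus_periodic f : Prop :=
  forall j : 'I_d, periodic f ((2 * pi) *: delta_mx ord0 j).

Definition Lp_norm p f : \bar R :=
  'N[torus_measure d]_p[EFin \o (f \o row_of_tuple)].

Definition Lp p : set ('rV[R]_d -> R) :=
  [set f | torus_periodic f /\ f \o row_of_tuple \in Lfun (torus_measure d) p].

Definition difference t (j : 'I_d) f : 'rV[R]_d -> R :=
  fun x => f (x + t *: delta_mx ord0 j) - f x.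

(* The factors commute, so the order of the composition is immaterial. *)
Definition mixed_difference (l : nat) (t : 'rV[R]_d) (e : {set 'I_d}) f :
    'rV[R]_d -> R :=
  foldr (fun j g => iter l (difference (t ord0 j) j) g) f (enum e).

Definition H_class r p : set ('rV[R]_d -> R) :=
  [set f | Lp p f /\
     forall (e : {set 'I_d}) (t : 'rV[R]_d),
       (Lp_norm p (mixed_difference (Num.truncn r).+1 t e f)
         <= (\prod_(j in e) (`|t ord0 j| `^ r))%:E)%E].

(* The continuous representatives of the elements of [H_class r p]: the defining
   conditions do not depend on the representative. *)
Definition H_cont r p : set ('rV[R]_d -> R) :=
  [set f | H_class r p f /\ continuous f].

Definition discretization_error (m : nat) (xi : 'I_m -> 'rV[R]_d) f : \bar R :=
  `| Lp_norm 2%:E f ^+ 2 - (m%:R^-1 * \sum_(j < m) `|f (xi j)| ^+ 2)%:E |%E.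

Definition er (m : nat) (W : set ('rV[R]_d -> R)) : \bar R :=
  ereal_inf [set ereal_sup [set discretization_error xi f | f in W]
            | xi in [set xi : 'I_m -> 'rV[R]_d | forall j, torus (xi j)]].

End classes.

(* Main.v *)
(** Expand f in martingale blocks delta_s over the b-adic boxes of sides
    2 pi b^-(s_j). Averaging the mixed differences gives
    ||delta_s f||_p <= C b^(-r|s|). Sample f on a net of b^n points that has
    exactly one point in every b-adic box of volume b^-n; it exists for every
    prime b >= d. On such a net the mean of delta_s f delta_t f is exact
    when |max(s,t)| <= n, while the discrete L_p mean of delta_s f exceeds
    the continuous one by at most the factor b^((|s|-n)_+/p). Since r > 1/p, the
    errors of the pairs with |max(s,t)| > n sum up to C n^(d-1) b^(-rn).
    For general m, take a union of nets of decreasing sizes. This gives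
    m^(-r) (log m)^(d-1), slightly better than required.

    The averages are taken on a fine grid of b^M points per coordinate, so that
    integrals only enter through Riemann sums, whose errors vanish as M grows
    with f fixed. *)
Require Import Defs.
From mathcomp Require Import all_boot all_order all_algebra.
From mathcomp Require Import all_classical all_reals all_analysis.
From mathcomp Require Import measurable_realfun ess_sup_inf ring lra zify.
Import Order.TTheory GRing.Theory Num.Theory.
Import numFieldNormedType.Exports.
Local Open Scope ring_scope.

(** * Averages over boxes of a grid *)

(** The rate hinges on counting the net's loss from level n only. Counted from level 0, the losses
    of a pair would cost b^((|s|+|t|)/p) and leave the rate b^(-(r-1/p)n). Counted from level n they
    cost at most b^((|s|+|t|-n)/p), because (S-n)_+ + (T-n)_+ <= S+T-n when S+T >= n. The gained
    factor b^(-n/p) restores b^(-rn).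

    In each coordinate only the larger level of a pair enters |max(s,t)|, and the smaller one is
    summed geometrically. So the sum over pairs has the logarithmic power of a sum over single
    multi-indices, n^(d-1).

    The prime b >= d supplies d distinct elements of F_b, at which polynomials of degree < n are
    expanded; the resulting points are the first b^n points of the Faure sequence. They depend
    neither on f nor on the auxiliary grid, whose fineness does depend on f.

    For p = infinity the argument runs with a finite exponent q > max(2, 1/r) in place of p. *)

Section one_dimensional_averages.
Context {R : realType}.
Implicit Types (a : nat -> R) (q : R).

(* Young's inequality for a t and m^(q-1) is the tangent line inequality for
   x^q at the mean m. *)
Lemma powR_mean_le (L : nat) (a : 'I_L -> R) q : (0 < L)%N -> 1 < q ->
  (forall t, 0 <= a t) ->
  (L%:R^-1 * \sum_(t < L) a t) `^ q <= L%:R^-1 * \sum_(t < L) a t `^ q.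
Proof.
move=> L0 q1 a0; set m := L%:R^-1 * _.
have L0' : 0 < L%:R :> R by rewrite ltr0n.
have q0 : 0 < q by exact: lt_trans q1.
have q10 : 0 < q - 1 by rewrite subr_gt0.
have m0 : 0 <= m by rewrite mulr_ge0 ?invr_ge0 ?sumr_ge0.
have young t : a t * m `^ (q - 1) <= a t `^ q / q + m `^ q * (1 - q^-1).
  have := @conjugate_powR R (a t) (m `^ (q - 1)) q (q / (q - 1)) (a0 t) (powR_ge0 _ _) q0.
  rewrite divr_gt0// => /(_ isT).
  have qq : q^-1 + (q / (q - 1))^-1 = 1 by field; rewrite !gt_eqF.
  move=> /(_ qq); rewrite -powRrM mulrCA divff ?gt_eqF// mulr1.
  have -> // : (q / (q - 1))^-1 = 1 - q^-1 by field; rewrite !gt_eqF.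
have : L%:R^-1 * \sum_(t < L) a t * m `^ (q - 1) <=
    L%:R^-1 * \sum_(t < L) (a t `^ q / q + m `^ q * (1 - q^-1)).
  by rewrite ler_pM2l ?invr_gt0//; exact: ler_sum.
rewrite -mulr_suml mulrA -/m big_split/= -mulr_suml sumr_const card_ord.
rewrite mulrDr -(mulr_natl (_ * _) L) !mulrA mulVf ?gt_eqF// mul1r.
have -> : m * m `^ (q - 1) = m `^ q.
  have [->|mn0] := eqVneq m 0; first by rewrite mul0r powR0 ?gt_eqF.
  by rewrite -{1}(powRr1 m0) -powRD ?mn0 ?implybT// addrC subrK.
rewrite mulrBr mulr1 addrCA lerDl subr_ge0 ler_pM2r ?invr_gt0//.
Qed.

(** Conditional expectation on the boxes of length [L]; [i %/ L * L] is the left end of the box of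
    [i]. *)
Definition box_mean (L : nat) a (i : nat) : R :=
  L%:R^-1 * \sum_(t < L) a (i %/ L * L + t)%N.

Lemma sum_boxes (Q L : nat) a :
  \sum_(i < Q * L) a i = \sum_(c < Q) \sum_(t < L) a (c * L + t)%N.
Proof.
elim: Q => [|Q IH]; first by rewrite mul0n !big_ord0.
rewrite big_ord_recr/= -IH -!(big_mkord xpredT a) mulSn addnC.
rewrite (big_cat_nat _ _ (n := Q * L))//= ?leq_addr//; congr (_ + _).
by rewrite -{1}[(Q * L)%N]add0n big_addn addKn big_mkord; apply: eq_bigr => t _; rewrite addnC.
Qed.

Lemma box_mean_in_box (L c u : nat) a : (u < L)%N ->
  box_mean L a (c * L + u)%N = L%:R^-1 * \sum_(t < L) a (c * L + t)%N.
Proof.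
by move=> uL; rewrite /box_mean divnMDl ?divn_small ?addn0//; case: L uL.
Qed.

(** Jensen's inequality in each box: conditional expectation contracts the mean of order [q]. *)
Lemma box_mean_powR_le (Q L : nat) a q : (0 < L)%N -> 1 < q ->
  \sum_(i < Q * L) `|box_mean L a i| `^ q <= \sum_(i < Q * L) `|a i| `^ q.
Proof.
move=> L0 q1; have q0 : 0 < q by exact: lt_trans q1.
rewrite (sum_boxes _ _ (fun i => `|box_mean L a i| `^ q)).
rewrite (sum_boxes _ _ (fun i => `|a i| `^ q)).
apply: ler_sum => c _.
under eq_bigr do rewrite box_mean_in_box//.
rewrite sumr_const card_ord.
have L0' : 0 < L%:R :> R by rewrite ltr0n.
rewrite -[leRHS](@mulVKf _ L%:R) ?gt_eqF// -(mulr_natl (`|_| `^ _) L) ler_pM2l//.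
apply: le_trans (@powR_mean_le L (fun t => `|a (c * L + t)%N|) q L0 q1 _) => //.
rewrite ge0_ler_powR ?nnegrE// ?(ltW q0)//.
  by rewrite mulr_ge0 ?invr_ge0 ?sumr_ge0.
by rewrite normrM ger0_norm ?invr_ge0// ler_pM2l ?invr_gt0//; exact: ler_norm_sum.
Qed.

(** Pairs with [u <= t] are indexed by the shift [v = t - u], the others follow by symmetry. Only
    shifts [v >= 0] make sense on [nat]; the terms with [u + v >= L] are nonnegative extras. *)
Lemma sum_sym_pairs_le (L : nat) (h : nat -> nat -> R) :
  (forall u v, 0 <= h u v) -> (forall u v, h u v = h v u) ->
  \sum_(u < L) \sum_(t < L) h u t <= 2 * \sum_(v < L) \sum_(u < L) h u (u + v)%N.
Proof.
move=> h0 hC.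
have half (u : 'I_L) : \sum_(t < L | (u <= t)%N) h u t <= \sum_(v < L) h u (u + v)%N.
  rewrite -(big_geq_mkord _ _ xpredT (h u)) -{1}[u : nat]add0n big_addn.
  rewrite -(big_mkord xpredT (fun v => h u (u + v)%N)).
  rewrite [leRHS](big_cat_nat _ _ (n := (L - u)%N))//= ?leq_subr//.
  apply: ler_wpDr; first by rewrite sumr_ge0.
  by apply: ler_sum => v _; rewrite addnC.
rewrite mulr_natl mulr2n [X in _ <= X + X]exchange_big/=.
have split (u : 'I_L) : \sum_(t < L) h u t <=
    \sum_(t < L | (u <= t)%N) h u t + \sum_(t < L | (t <= u)%N) h u t.
  rewrite [X in _ <= _ + X]big_mkcond [X in _ <= X + _]big_mkcond -big_split/=.
  apply: ler_sum => t _; case: (leqP u t) => ut; last by rewrite ltnW// add0r.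
  by rewrite lerDl; case: ifP.
apply: (le_trans (ler_sum _ (fun u _ => split u))).
rewrite big_split/=; apply: lerD; first exact: ler_sum.
rewrite (exchange_big_dep xpredT)//=; apply: ler_sum => t _.
by apply: le_trans (half t); apply: ler_sum => u _; rewrite hC.
Qed.

(** Jensen's inequality bounds the deviation from the mean by an average over pairs in the box,
    which is then rewritten as an average over shifts; this costs the factor 2. The shifted index
    may leave the range of summation. *)
Lemma box_mean_sub_powR_le (Q L : nat) a q : (0 < L)%N -> 1 < q ->
  \sum_(i < Q * L) `|box_mean L a i - a i| `^ q <=
  2 * L%:R^-1 * \sum_(v < L) \sum_(i < Q * L) `|a (i + v)%N - a i| `^ q.
Proof.
move=> L0 q1; have q0 : 0 < q by exact: lt_trans q1.
have L0' : 0 < L%:R :> R by rewrite ltr0n.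
rewrite (sum_boxes _ _ (fun i => `|box_mean L a i - a i| `^ q)).
under [X in _ <= _ * X]eq_bigr => v _ do
  rewrite (sum_boxes _ _ (fun i => `|a (i + v)%N - a i| `^ q)).
rewrite [X in _ <= _ * X]exchange_big/= mulr_sumr; apply: ler_sum => c _.
pose h u t : R := `|a (c * L + t)%N - a (c * L + u)%N| `^ q.
have mean_le (u : 'I_L) :
    `|box_mean L a (c * L + u)%N - a (c * L + u)%N| `^ q <= L%:R^-1 * \sum_(t < L) h u t.
  rewrite box_mean_in_box//.
  apply: le_trans (@powR_mean_le L (fun t => `|a (c * L + t)%N - a (c * L + u)%N|) q L0 q1 _) => //.
  rewrite ge0_ler_powR ?nnegrE// ?(ltW q0)//.
    by rewrite mulr_ge0 ?invr_ge0 ?sumr_ge0.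
  have -> : L%:R^-1 * \sum_(t < L) a (c * L + t)%N - a (c * L + u)%N =
      L%:R^-1 * \sum_(t < L) (a (c * L + t)%N - a (c * L + u)%N).
    by rewrite sumrB mulrBr sumr_const card_ord -(mulr_natl (a _) L) mulKf ?gt_eqF.
  rewrite normrM ger0_norm ?invr_ge0// ler_pM2l ?invr_gt0//; exact: ler_norm_sum.
apply: (le_trans (ler_sum _ (fun u _ => mean_le u))).
rewrite -mulr_sumr mulrAC [leRHS]mulrC ler_pM2l ?invr_gt0//.
apply: (le_trans (@sum_sym_pairs_le L h _ _)).
- by move=> u v; exact: powR_ge0.
- by move=> u v; rewrite /h distrC.
rewrite ler_pM2l//; apply: ler_sum => v _; apply: ler_sum => u _.
by rewrite /h addnA.
Qed.

Lemma powR_sub_le (x y q : R) : 0 < q ->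
  `|x - y| `^ q <= 2 `^ q * (`|x| `^ q + `|y| `^ q).
Proof.
move=> q0.
wlog xy : x y / `|x| <= `|y|.
  by move=> H; case: (leP `|x| `|y|) => [/H//|/ltW/H]; rewrite distrC (addrC (`|y| `^ q)).
apply: (@le_trans _ _ ((2 * `|y|) `^ q)).
  rewrite ge0_ler_powR ?nnegrE// ?(ltW q0)//.
  by rewrite (le_trans (ler_normB _ _))// mulr_natl mulr2n lerD.
by rewrite powRM// ler_pM2l ?powR_gt0// lerDr powR_ge0.
Qed.

End one_dimensional_averages.

Section grid_operators.
Context {R : realType} {d : nat}.
Implicit Types (F g : ('I_d -> nat) -> R) (x : 'I_d -> nat) (q : R).

Definition upd x j v : 'I_d -> nat := fun k => if k == j then v else x k.

Lemma upd_same x j v : upd x j v j = v.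
Proof. by rewrite /upd eqxx. Qed.

Lemma updupd x j v w : upd (upd x j v) j w = upd x j w.
Proof. by apply/funext => k; rewrite /upd; case: eqP. Qed.

Lemma updC x j k v w : j != k -> upd (upd x j v) k w = upd (upd x k w) j v.
Proof.
move=> jk; apply/funext => i; rewrite /upd; case: eqP => // ->.
by rewrite eq_sym (negPf jk).
Qed.

Lemma upd_other x j k v : j != k -> upd x j v k = x k.
Proof. by move=> jk; rewrite /upd eq_sym (negPf jk). Qed.

(** Grid functions live on all of [nat ^ d] and only the sum is confined to a cube, so that shifts
    may step over its boundary. *)
Definition gsum N F : R := \sum_(x : {ffun 'I_d -> 'I_N}) F (fun j => x j : nat).

(** Fubini in the coordinate [j]. Exchanging the new value [i] with [x j] is an involution on pairs,
    so no coordinate has to be split off. *)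
Lemma gsum_upd N j F :
  \sum_(i < N) gsum N (fun x => F (upd x j i)) = N%:R * gsum N F.
Proof.
rewrite /gsum pair_big /=.
pose h (p : 'I_N * {ffun 'I_d -> 'I_N}) :=
  (p.2 j, [ffun k => if k == j then p.1 else p.2 k]).
have hK : cancel h h.
  move=> [i x]; rewrite /h /= ffunE eqxx; congr pair; apply/ffunP => k.
  by rewrite !ffunE; case: eqP => [->|].
rewrite (reindex_inj (can_inj hK)).
transitivity (\sum_(p : 'I_N * {ffun 'I_d -> 'I_N}) F (fun j => p.2 j : nat)).
  apply: eq_bigr => -[i x] _ /=; congr F; apply/funext => k; rewrite /upd ffunE.
  by case: eqP => [->|].
rewrite -(pair_big xpredT xpredT
  (fun (_ : 'I_N) (x : {ffun 'I_d -> 'I_N}) => F (fun j => x j : nat))) /=.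
by rewrite sumr_const card_ord mulr_natl.
Qed.

Lemma ler_gsum N F g : (forall x, F x <= g x) -> gsum N F <= gsum N g.
Proof. by move=> Fg; apply: ler_sum. Qed.

(** The passage from one-dimensional estimates to the grid: an inequality on every line parallel to
    the axis [j] sums up. *)
Lemma gsum_line_le N j F g c : 0 < c ->
  (forall x, \sum_(i < N) F (upd x j i) <= c * \sum_(i < N) g (upd x j i)) ->
  gsum N F <= c * gsum N g.
Proof.
have [->|N0] := posnP N.
  move=> c0 _; rewrite /gsum [X in X <= _]big1 ?[X in _ * X]big1 ?mulr0//.
  - by move=> x; case: (x j).
  - by move=> x; case: (x j).
move=> c0 Fg; have N0' : 0 < N%:R :> R by rewrite ltr0n.
rewrite -(ler_pM2l N0') mulrCA -!(gsum_upd _ j) mulr_sumr /gsum.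
under [leRHS]eq_bigr do rewrite mulr_sumr.
rewrite exchange_big [leRHS]exchange_big/=; apply: ler_sum => x _.
by rewrite -mulr_sumr.
Qed.

Definition avg L j g x : R := box_mean L (fun i => g (upd x j i)) (x j).

Definition dif t j g x : R := g (upd x j (x j + t)) - g x.

Lemma avg_upd L j g x i :
  avg L j g (upd x j i) = box_mean L (fun i => g (upd x j i)) i.
Proof.
by rewrite /avg upd_same; congr box_mean; apply/funext => k; rewrite updupd.
Qed.

Lemma avg_powR_le Q L j g q : (0 < L)%N -> 1 < q ->
  gsum (Q * L) (fun x => `|avg L j g x| `^ q) <=
  gsum (Q * L) (fun x => `|g x| `^ q).
Proof.
move=> L0 q1; rewrite -[leRHS]mul1r; apply: (@gsum_line_le _ j) => // x.
rewrite mul1r; under eq_bigr do rewrite avg_upd.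
exact: (@box_mean_powR_le R Q L (fun i => g (upd x j i))).
Qed.

Lemma avg_sub_powR_le Q L j g q (B : R) : (0 < L)%N -> 1 < q ->
  (forall t, (t < L)%N -> gsum (Q * L) (fun x => `|dif t j g x| `^ q) <= B) ->
  gsum (Q * L) (fun x => `|avg L j g x - g x| `^ q) <= 2 * B.
Proof.
move=> L0 q1 HB; have L0' : 0 < L%:R :> R by rewrite ltr0n.
pose G x : R := \sum_(t < L) `|dif t j g x| `^ q.
apply: (@le_trans _ _ (2 * L%:R^-1 * gsum (Q * L) G)).
  apply: (@gsum_line_le _ j); first by rewrite divr_gt0.
  move=> x; under eq_bigr do rewrite avg_upd.
  apply: (le_trans (@box_mean_sub_powR_le R Q L (fun i => g (upd x j i)) q L0 q1)).
  rewrite ler_pM2l ?divr_gt0// exchange_big/=.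
  by apply: ler_sum => i _; apply: ler_sum => t _; rewrite /dif updupd upd_same.
rewrite -mulrA ler_pM2l// mulrC ler_pdivrMr// /gsum /G exchange_big/=.
apply: (@le_trans _ _ (\sum_(t < L) B)); last by rewrite sumr_const card_ord mulr_natr.
by apply: ler_sum => t _; exact: HB.
Qed.

Lemma difC s t j k g : j != k -> dif s j (dif t k g) = dif t k (dif s j g).
Proof.
move=> jk; have kj : k != j by rewrite eq_sym.
apply/funext => x; rewrite /dif !upd_other// updC//; ring.
Qed.

Lemma dif_avgC t L j k g : j != k -> dif t j (avg L k g) = avg L k (dif t j g).
Proof.
move=> jk; have kj : k != j by rewrite eq_sym.
apply/funext => x; rewrite /dif /avg /box_mean upd_other// -mulrBr -sumrB.
by congr (_ * _); apply: eq_bigr => i _; rewrite updC// upd_other.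
Qed.

End grid_operators.

(** * Martingale blocks on a grid and mixed differences *)

Section martingale_blocks.
Context {R : realType} {d : nat}.
Implicit Types (g : ('I_d -> nat) -> R) (x : 'I_d -> nat) (q : R).
Context (b M : nat) (b1 : (1 < b)%N).

(* The factor of a block in coordinate j; b^(M - k) grid steps make up a b-adic
   interval of level k. *)
Definition lam k j g x : R :=
  avg (b ^ (M - k)) j g x - (if k is k'.+1 then avg (b ^ (M - k')) j g x else 0).

Lemma dif_lamC t k j i g : j != i -> dif t j (lam k i g) = lam k i (dif t j g).
Proof.
move=> ji; apply/funext => x; rewrite /lam.
case: k => [|k]; rewrite -!(dif_avgC _ _ _ _ _ ji) /dif; ring.
Qed.

Let bexp_gt0 n : (0 < b ^ n)%N.
Proof. by rewrite expn_gt0 (ltn_trans _ b1). Qed.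

Let bM k : (k <= M)%N -> (b ^ M = b ^ k * b ^ (M - k))%N.
Proof. by move=> kM; rewrite -expnD subnKC. Qed.

Lemma lam0_powR_le j g q : 1 < q ->
  gsum (b ^ M) (fun x => `|lam 0 j g x| `^ q) <= gsum (b ^ M) (fun x => `|g x| `^ q).
Proof.
move=> q1; under [leLHS]eq_bigr do rewrite /lam subr0 subn0.
by have := @avg_powR_le R d 1 (b ^ M) j g q (bexp_gt0 M) q1; rewrite mul1n.
Qed.

(** Both averages in [lam] are compared with [g]. Shifts below the coarser box length [b ^ (M - k)]
    serve for both, and the factor 4 is twice the factor 2 of one comparison. *)
Lemma lamS_powR_le k j g q B : 1 < q -> (k < M)%N ->
  (forall t, (t < b ^ (M - k))%N -> gsum (b ^ M) (fun x => `|dif t j g x| `^ q) <= B) ->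
  gsum (b ^ M) (fun x => `|lam k.+1 j g x| `^ q) <= 4 * 2 `^ q * B.
Proof.
move=> q1 kM HB; have q0 : 0 < q by exact: lt_trans q1.
apply: (@le_trans _ _ (gsum (b ^ M) (fun x =>
    2 `^ q * (`|avg (b ^ (M - k.+1)) j g x - g x| `^ q +
              `|avg (b ^ (M - k)) j g x - g x| `^ q)))).
  apply: ler_gsum => x; apply: le_trans (powR_sub_le _ _ _ q0).
  by rewrite /lam opprB addrA subrK.
rewrite /gsum -mulr_sumr mulrAC [leRHS]mulrC ler_pM2l ?powR_gt0// big_split/=.
have -> : 4 * B = 2 * B + 2 * B by ring.
apply: lerD.
- have := @avg_sub_powR_le R d (b ^ k.+1) (b ^ (M - k.+1)) j g q B (bexp_gt0 _) q1.
  rewrite -bM//; apply => t tL; apply: HB; apply: leq_trans tL _.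
  by rewrite leq_pexp2l ?(ltnW b1)// leq_sub2l.
- have := @avg_sub_powR_le R d (b ^ k) (b ^ (M - k)) j g q B (bexp_gt0 _) q1.
  by rewrite -bM ?(ltnW kM)//; exact.
Qed.

Definition block (s : 'I_d -> nat) (js : seq 'I_d) g :=
  foldr (fun j h => lam (s j) j h) g js.

Definition mixed_dif (t : 'I_d -> nat) (js : seq 'I_d) g :=
  foldr (fun j h => dif (t j) j h) g js.

Lemma dif_blockC t j s js g : j \notin js ->
  dif t j (block s js g) = block s js (dif t j g).
Proof.
elim: js => //= k js IH; rewrite inE negb_or => /andP[jk jjs].
by rewrite dif_lamC// IH.
Qed.

Lemma dif_mixed_difC t j u js g : j \notin js ->
  dif t j (mixed_dif u js g) = mixed_dif u js (dif t j g).
Proof.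
elim: js => //= k js IH; rewrite inE negb_or => /andP[jk jjs].
by rewrite difC// IH.
Qed.

Lemma eq_mixed_dif u v js g : {in js, u =1 v} -> mixed_dif u js g = mixed_dif v js g.
Proof.
elim: js => //= k js IH uv; rewrite uv ?mem_head// IH// => i ijs.
by rewrite uv// inE ijs orbT.
Qed.

(* An average in one coordinate commutes with the differences in the others, so
   the factors with s j > 0 are traded for differences one at a time. *)
Lemma block_powR_le s js g q B : 1 < q -> uniq js -> 0 <= B ->
  (forall j, s j <= M)%N ->
  (forall t, (forall j, j \in js -> 0 < s j -> t j < b ^ (M - (s j).-1))%N ->
    gsum (b ^ M) (fun x => `|mixed_dif t [seq j <- js | (0 < s j)%N] g x| `^ q) <= B) ->
  gsum (b ^ M) (fun x => `|block s js g x| `^ q) <= (4 * 2 `^ q) ^+ size js * B.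
Proof.
move=> q1 + B0 sM; have c1 : 1 <= 4 * 2 `^ q :> R.
  rewrite (le_trans (_ : 1 <= 4 * 1 :> R))//; first by rewrite mulr1 ler1n.
  rewrite ler_pM2l//; apply: (@le_trans _ _ (1 `^ q)); first by rewrite powR1.
  by rewrite ge0_ler_powR ?nnegrE ?ler1n ?(ltW (lt_trans _ q1)).
elim: js g => [|j js IH] g /=.
  by move=> _ /(_ (fun=> 0%N)); rewrite expr0 mul1r; exact.
move=> /andP[jjs ujs] HB; case sj : (s j) => [|k]; rewrite sj/= in HB.
  (* Level 0 is a plain average: a contraction that asks for no difference in [j]. *)
  apply: (le_trans (@lam0_powR_le _ _ _ q1)).
  apply: (@le_trans _ _ ((4 * 2 `^ q) ^+ size js * B)); last first.
    by rewrite ler_wpM2r// ler_weXn2l.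
  apply: IH => // t ht; apply: HB => i; rewrite inE => /predU1P[->|/ht//].
  by rewrite sj.
rewrite exprS -mulrA; apply: lamS_powR_le => //; first by rewrite -sj.
move=> t tL; rewrite dif_blockC//; apply: IH => // u hu.
(* The shift [t] in coordinate [j] joins the shifts [u] of the induction hypothesis in one
   family. *)
pose v := upd u j t.
have vu : {in [seq j <- js | (0 < s j)%N], v =1 u}.
  move=> i; rewrite mem_filter => /andP[_ ijs]; rewrite /v upd_other//.
  by apply: contraNneq jjs => ->.
rewrite -dif_mixed_difC ?mem_filter ?(negPf jjs) ?andbF//.
rewrite -(eq_mixed_dif _ _ _ _ vu) -{1}(upd_same u j t) -/v.
apply: HB => i; rewrite inE => /predU1P[->|ijs si].
  by rewrite /v upd_same sj.
by rewrite /v upd_other ?hu//; apply: contraNneq jjs => ->.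
Qed.

End martingale_blocks.

Section block_structure.
Context {R : realType} {d : nat} (b M : nat) (b1 : (1 < b)%N).
Implicit Types (g h : ('I_d -> nat) -> R) (x y s : 'I_d -> nat).

Let bexp_gt0 n : (0 < b ^ n)%N.
Proof. by rewrite expn_gt0 (ltn_trans _ b1). Qed.

Lemma avg_sum (I : finType) L j (h : I -> ('I_d -> nat) -> R) x :
  avg L j (fun y => \sum_i h i y) x = \sum_i avg L j (h i) x.
Proof. by rewrite /avg /box_mean exchange_big/= mulr_sumr. Qed.

Lemma avgZ L j h c x : avg L j (fun y => c * h y) x = c * avg L j h x.
Proof. by rewrite /avg /box_mean -mulr_sumr mulrCA. Qed.

Lemma sum_lam K j h x :
  \sum_(k < K.+1) lam b M k j h x = avg (b ^ (M - K)) j h x.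
Proof.
elim: K => [|K IH]; first by rewrite big_ord1 /lam subr0.
by rewrite big_ord_recr/= IH /lam addrC subrK.
Qed.

Definition coarse K (js : seq 'I_d) g : ('I_d -> nat) -> R :=
  foldr (fun j h => avg (b ^ (M - K)) j h) g js.

Lemma block_upd s j k js g : j \notin js ->
  block b M (upd s j k) js g = block b M s js g.
Proof.
elim: js => //= i js IH; rewrite inE negb_or => /andP[ji /IH ->].
by rewrite upd_other.
Qed.

Lemma gsum_const N (c : R) : gsum (d := d) N (fun=> c) = N%:R ^+ d * c.
Proof.
by rewrite /gsum sumr_const card_ffun !card_ord -[LHS]mulr_natl natrX.
Qed.

(** The sum runs over the levels of all [d] coordinates although only those in [js] matter. Each
    other coordinate contributes a factor [K.+1]; the two powers account for this without
    division. *)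
Lemma sum_block_scaled K js g x : uniq js ->
  K.+1%:R ^+ size js * gsum K.+1 (fun s => block b M s js g x) =
  K.+1%:R ^+ d * coarse K js g x.
Proof.
elim: js x => [|j js IH] x /=; first by rewrite mul1r gsum_const.
move=> /andP[jjs ujs]; rewrite exprSr -mulrA -(gsum_upd _ j).
transitivity (K.+1%:R ^+ size js *
    gsum K.+1 (fun s => \sum_(k < K.+1) lam b M k j (block b M s js g) x)).
  rewrite /gsum exchange_big/=; congr (_ * _); apply: eq_bigr => k _.
  by apply: eq_bigr => s _; rewrite upd_same block_upd.
rewrite /gsum; under eq_bigr do rewrite sum_lam.
rewrite -avg_sum -!avgZ; congr (avg _ j _ x); apply/funext => y.
exact: IH.
Qed.

Lemma sum_block K g x :
  gsum K.+1 (fun s => block b M s (enum 'I_d) g x) = coarse K (enum 'I_d) g x.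
Proof.
have := sum_block_scaled K (enum 'I_d) g x (enum_uniq _).
by rewrite size_enum_ord; apply: mulfI; rewrite expf_neq0// pnatr_eq0.
Qed.

(** Averaging in one coordinate moves the value by at most the oscillation [w] along that coordinate
    inside a box, and these errors add up. *)
Lemma coarse_close K js g (w : R) x :
  (forall x j v, (v %/ b ^ (M - K) = x j %/ b ^ (M - K))%N ->
    `|g (upd x j v) - g x| <= w) ->
  `|coarse K js g x - g x| <= (size js)%:R * w.
Proof.
move=> gw; elim: js x => [|j js IH] x /=; first by rewrite subrr normr0 mul0r.
set L := (b ^ (M - K))%N; have L0 : (0 < L)%N by exact: bexp_gt0.
have L0' : 0 < L%:R :> R by rewrite ltr0n.
pose X (t : 'I_L) := upd x j (x j %/ L * L + t).
have -> : avg L j (coarse K js g) x - g x =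
    L%:R^-1 * \sum_(t < L) (coarse K js g (X t) - g x).
  rewrite sumrB sumr_const card_ord mulrBr -(mulr_natl (g x) L) mulKf ?gt_eqF//.
rewrite normrM ger0_norm ?invr_ge0// mulrC ler_pdivrMr//.
apply: (le_trans (ler_norm_sum _ _ _)).
apply: (@le_trans _ _ (\sum_(t < L) ((size js).+1%:R * w))); last first.
  by rewrite sumr_const card_ord mulr_natr.
apply: ler_sum => t _; apply: (le_trans (ler_distD (g (X t)) _ _)).
rewrite -natr1 mulrDl mul1r; apply: lerD; first exact: IH.
by apply: gw; rewrite -/L divnMDl// (divn_small (ltn_ord t)) addn0.
Qed.

Definition same_cell s x y := forall j, (x j %/ b ^ (M - s j) = y j %/ b ^ (M - s j))%N.

(** Measurability with respect to the partition into cells of level [s]. *)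
Definition leveled s g := forall x y, same_cell s x y -> g x = g y.

Lemma same_cell_coarser s u x y : (forall j, s j <= u j <= M)%N ->
  same_cell u x y -> same_cell s x y.
Proof.
move=> su xy j; have /andP[sj uM] := su j.
have -> : (M - s j = (M - u j) + (u j - s j))%N by lia.
by rewrite expnD !divnMA xy.
Qed.

Lemma leveled_coarser s u g : (forall j, s j <= u j <= M)%N ->
  leveled s g -> leveled u g.
Proof. by move=> su sg x y xy; apply: sg; exact: same_cell_coarser xy. Qed.

Lemma avg_cell L j h h' x y : (x j %/ L = y j %/ L)%N ->
  (forall v, h (upd x j v) = h' (upd y j v)) -> avg L j h x = avg L j h' y.
Proof.
by move=> xy hh; rewrite /avg /box_mean xy; congr (_ * _); apply: eq_bigr.
Qed.

Lemma block_cell s js g x y : (forall j, s j <= M)%N ->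
  (forall j, j \in js -> x j %/ b ^ (M - s j) = y j %/ b ^ (M - s j))%N ->
  (forall j, j \notin js -> x j = y j) ->
  block b M s js g x = block b M s js g y.
Proof.
move=> sM; elim: js x y => [|j js IH] x y /= xyin xyout.
  by congr g; apply/funext => j; exact: xyout.
have xy := xyin j (mem_head _ _).
have rest v : block b M s js g (upd x j v) = block b M s js g (upd y j v).
  apply: IH => i ijs; rewrite /upd; case: eqP => // /eqP ij.
    by apply: xyin; rewrite inE ijs orbT.
  by apply: xyout; rewrite inE negb_or ij.
rewrite /lam; congr (_ - _); first exact: avg_cell.
move: xy (sM j); case: (s j) => // k xy kM; apply: avg_cell => //.
have -> : (M - k = (M - k.+1) + 1)%N by lia.
by rewrite expnD !divnMA xy.
Qed.

Lemma leveled_block s g : (forall j, s j <= M)%N -> leveled s (block b M s (enum 'I_d) g).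
Proof.
by move=> sM x y xy; apply: block_cell => // j; rewrite mem_enum.
Qed.

End block_structure.

(** * Nets *)

Section nets.
Context {R : realType} {d : nat} (b M : nat) (b1 : (1 < b)%N).
Context (T : finType) (pt : T -> 'I_d -> nat) (ptM : forall P j, (pt P j < b ^ M)%N).
Implicit Types (g h : ('I_d -> nat) -> R) (x y s : 'I_d -> nat).

Let bexp_gt0 n : (0 < b ^ n)%N.
Proof. by rewrite expn_gt0 (ltn_trans _ b1). Qed.

(** Written as a product so that its sum over the grid factors over the coordinates. *)
Definition cell_indic s x y : R :=
  \prod_j (x j %/ b ^ (M - s j) == y j %/ b ^ (M - s j))%N%:R.

Lemma cell_indicP s x y :
  (same_cell b M s x y /\ cell_indic s x y = 1) \/
  (~ same_cell b M s x y /\ cell_indic s x y = 0).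
Proof.
have [/forallP xy|/forallPn[j xy]] := boolP [forall j,
    (x j %/ b ^ (M - s j) == y j %/ b ^ (M - s j))%N].
  left; split; first by move=> j; exact/eqP.
  by rewrite /cell_indic big1// => j _; rewrite xy.
right; split; first by move=> /(_ j)/eqP; rewrite (negPf xy).
by rewrite /cell_indic (bigD1 j)//= (negPf xy) mul0r.
Qed.

Lemma gsum_cell_indic s x : (forall j, s j <= M)%N -> (forall j, x j < b ^ M)%N ->
  gsum (b ^ M) (cell_indic s x) = (b ^ \sum_j (M - s j))%N%:R.
Proof.
move=> sM xM; rewrite /gsum /cell_indic.
rewrite -(bigA_distr_bigA (fun j (i : 'I_(b ^ M)) =>
  (x j %/ b ^ (M - s j) == i %/ b ^ (M - s j))%N%:R))/=.
rewrite expn_sum natr_prod; apply: eq_bigr => j _.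
set L := (b ^ (M - s j))%N.
have bML : (b ^ M = b ^ s j * L)%N by rewrite -expnD subnKC.
have xL : (x j %/ L < b ^ s j)%N by rewrite ltn_divLR ?bexp_gt0// -bML.
rewrite -(big_mkord xpredT (fun i => (x j %/ L == i %/ L)%N%:R)) bML big_mkord.
rewrite (sum_boxes _ _ (fun i => (x j %/ L == i %/ L)%N%:R)).
rewrite (bigD1 (Ordinal xL))//= [X in _ + X]big1 ?addr0.
  under eq_bigr => t _ do rewrite divnMDl ?bexp_gt0// (divn_small (ltn_ord t)) addn0 eqxx.
  by rewrite sumr_const card_ord.
move=> c cx; rewrite big1// => t _; rewrite divnMDl ?bexp_gt0// (divn_small (ltn_ord t)) addn0.
by case: eqP => // xc; case/eqP: cx; exact: val_inj.
Qed.

Definition cell_count s x : R := \sum_P cell_indic s (pt P) x.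

(** Double counting of the pairs of a net point and a grid point in a common cell: the value at each
    net point is spread over the grid points of its cell. *)
Lemma sum_pt_scaled s g : (forall j, s j <= M)%N -> leveled b M s g ->
  (b ^ \sum_j (M - s j))%N%:R * \sum_P g (pt P) =
  gsum (b ^ M) (fun x => cell_count s x * g x).
Proof.
move=> sM sg; rewrite /gsum /cell_count.
under [RHS]eq_bigr do rewrite mulr_suml.
rewrite exchange_big/= mulr_sumr; apply: eq_bigr => P _.
rewrite -(gsum_cell_indic _ _ sM (ptM P)) mulr_suml; apply: eq_bigr => x _.
have [[/sg -> //]|[_ ->]] := cell_indicP s (pt P) (fun j => x j).
by rewrite !mul0r.
Qed.

Lemma cell_count_le1 s x :
  (forall P Q, same_cell b M s (pt P) (pt Q) -> P = Q) -> cell_count s x <= 1.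
Proof.
move=> inj; rewrite /cell_count.
have [[P xP]|nP] := pselect (exists P, same_cell b M s (pt P) x).
  rewrite (bigD1 P)//= [X in _ + X]big1 ?addr0.
    by have [[_ ->]|[_ ->]] := cell_indicP s (pt P) x.
  move=> Q QP; have [[xQ _]|[_ ->//]] := cell_indicP s (pt Q) x.
  by case/eqP: QP; apply: inj => j; rewrite xP xQ.
rewrite big1// => P _; have [[xP _]|[_ ->//]] := cell_indicP s (pt P) x.
by case: nP; exists P.
Qed.

(** The one-sided bound for fine cells: some of them may contain no net point, which only lowers the
    left side when [g] is nonnegative. *)
Lemma sum_pt_le s g : (forall j, s j <= M)%N -> leveled b M s g ->
  (forall x, 0 <= g x) ->
  (forall P Q, same_cell b M s (pt P) (pt Q) -> P = Q) ->
  (b ^ \sum_j (M - s j))%N%:R * \sum_P g (pt P) <= gsum (b ^ M) g.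
Proof.
move=> sM sg g0 inj; rewrite sum_pt_scaled//; apply: ler_gsum => x.
by rewrite ler_piMl// cell_count_le1.
Qed.

(* The cells of the points have total size b^(M d), and no grid point is counted
   twice, hence every grid point is counted exactly once. *)
Lemma sum_pt_exact s g : (forall j, s j <= M)%N -> leveled b M s g ->
  #|T| = (b ^ \sum_j s j)%N ->
  (forall P Q, same_cell b M s (pt P) (pt Q) -> P = Q) ->
  (b ^ \sum_j (M - s j))%N%:R * \sum_P g (pt P) = gsum (b ^ M) g.
Proof.
move=> sM sg cT inj; rewrite sum_pt_scaled//; apply: eq_bigr => x _.
suff -> : cell_count s (fun j => x j) = 1 by rewrite mul1r.
have count1 := fun x => cell_count_le1 s x inj.
have sum0 : gsum (b ^ M) (fun x => 1 - cell_count s x) = 0.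
  transitivity (gsum (d := d) (b ^ M) (fun=> 1) -
      gsum (b ^ M) (fun x => cell_count s x * 1)); last first.
    rewrite -sum_pt_scaled// sumr_const cT -natrM mulnC -expnD -big_split/=.
    rewrite (eq_bigr (fun=> M)); last by move=> j _; rewrite subnKC.
    by rewrite sum_nat_const card_ord gsum_const mulr1 -natrX -expnM mulnC subrr.
  by rewrite /gsum -sumrB; apply: eq_bigr => y _; rewrite mulr1.
have := sum0; rewrite /gsum => /eqP; rewrite psumr_eq0; last first.
  by move=> y _; rewrite subr_ge0.
by move=> /allP/(_ x (mem_index_enum _)); rewrite subr_eq0 => /eqP.
Qed.

End nets.

Section digits.
Context (b : nat) (b1 : (1 < b)%N).
Implicit Types (c : nat -> nat).

(** Horner's scheme with [c 0] as leading digit, so that division by a power of [b] truncates the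
    expansion. *)
Fixpoint digval c n : nat := if n is m.+1 then digval c m * b + c m else 0.

Lemma digval_lt c n : (forall i, c i < b)%N -> (digval c n < b ^ n)%N.
Proof.
move=> cb; elim: n => [|n IH] /=; first by rewrite expn0.
rewrite expnSr (leq_trans (_ : _ < digval c n * b + b)%N) ?ltn_add2l//.
by rewrite -mulSnr leq_mul2r IH orbT.
Qed.

Lemma digval_div c n s : (forall i, c i < b)%N -> (s <= n)%N ->
  (digval c n %/ b ^ (n - s))%N = digval c s.
Proof.
move=> cb; elim: n => [|n IH]; first by rewrite leqn0 => /eqP ->; rewrite divn1.
rewrite leq_eqVlt => /predU1P[->|]; first by rewrite subnn expn0 divn1.
rewrite ltnS => sn; rewrite subSn// expnS divnMA /=.
by rewrite divnMDl ?(ltnW b1)// (divn_small (cb n)) addn0 IH.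
Qed.

Lemma digval_inj c c' s : (forall i, c i < b)%N -> (forall i, c' i < b)%N ->
  digval c s = digval c' s -> forall i, (i < s)%N -> c i = c' i.
Proof.
move=> cb cb'; elim: s => //= s IH E i.
have := congr1 (fun v => v %% b)%N E; rewrite !modnMDl !modn_small// => cs.
rewrite ltnS leq_eqVlt => /predU1P[->//|]; apply: IH.
move/eqP: E; rewrite cs eqn_add2r eqn_pmul2r ?(ltnW b1)//; by move/eqP.
Qed.

End digits.

(** * Nets from polynomials over a prime field *)

Section polynomial_net.
Context (b d n M : nat) (b_pr : prime b) (db : (d <= b)%N) (nM : (n <= M)%N).
Local Notation F := 'F_b.
Implicit Types (v w : 'rV[F]_n) (j : 'I_d).

Definition node j : F := (j : nat)%:R.

(** All representatives are below [b] because [d <= b], so no two agree modulo [b]. *)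
Lemma node_inj : injective node.
Proof.
move=> i j /(congr1 (fun z : F => z : nat)); rewrite !val_Fp_nat//.
by rewrite !modn_small ?(leq_trans (ltn_ord _))// => ij; exact: val_inj.
Qed.

(* A vector v stands for a polynomial of degree < n over F_b; the base b digits
   of coordinate j, most significant first, are its coefficients in powers of
   X - node j. *)
Definition net_digit v j i : nat :=
  nat_of_ord ((rVpoly v \Po ('X + (node j)%:P))`_i : F).

(** The factor [b ^ (M - n)] appends zero digits and places a point with [n] digits in the finer
    grid. *)
Definition net_point v j : nat := (digval b (net_digit v j) n * b ^ (M - n))%N.

Let b1 : (1 < b)%N := prime_gt1 b_pr.

Lemma net_digit_lt v j i : (net_digit v j i < b)%N.
Proof.
by rewrite /net_digit -[X in (_ < X)%N](Fp_cast b_pr) ltn_ord.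
Qed.

Lemma net_point_lt v j : (net_point v j < b ^ M)%N.
Proof.
rewrite /net_point -{2}(subnKC nM) expnD ltn_pmul2r ?expn_gt0 ?(ltnW b1)//.
exact: digval_lt (net_digit_lt v j).
Qed.

Lemma card_net : #|{: 'rV[F]_n}| = (b ^ n)%N.
Proof. by rewrite card_mx card_Fp// mul1n. Qed.

(** The coefficients of [p \Po ('X + a%:P)] are the Taylor coefficients of [p] at [a]; the first [u]
    vanish exactly when [a] is a root of multiplicity at least [u]. *)
Lemma dvdp_shifted_coefs (p : {poly F}) (a : F) u :
  (forall i, (i < u)%N -> (p \Po ('X + a%:P))`_i = 0) -> ('X - a%:P) ^+ u %| p.
Proof.
move=> pu; set q := p \Po ('X + a%:P).
have -> : p = q \Po ('X - a%:P).
  by rewrite /q -comp_polyA comp_polyD comp_polyX comp_polyC subrK comp_polyXr.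
rewrite -(poly_take_drop u q).
have -> : take_poly u q = 0.
  by apply/polyP => i; rewrite coef_take_poly coef0; case: ifP => // /pu.
by rewrite add0r comp_polyM rmorphXn/= comp_polyX dvdp_mull.
Qed.

Lemma prod_XsubC_exp_dvdp (p : {poly F}) (u : 'I_d -> nat) (js : seq 'I_d) : uniq js ->
  (forall j, ('X - (node j)%:P) ^+ u j %| p) ->
  \prod_(j <- js) ('X - (node j)%:P) ^+ u j %| p.
Proof.
move=> + pu; elim: js => [|j js IH]; first by rewrite big_nil dvd1p.
move=> /andP[jjs /IH djs]; rewrite big_cons Gauss_dvdp ?pu//.
rewrite big_seq; elim/big_ind: _ => [|q r|i ijs]; first by rewrite coprimep1.
  by rewrite coprimepMr => -> ->.
apply/coprimep_expl/coprimep_expr; rewrite coprimep_XsubC2// subr_eq0.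
by apply: contraNneq jjs => /node_inj <-.
Qed.

(* Points that share the first s j digits in every coordinate j come from
   polynomials whose difference is divisible by prod_j (X - node j)^(s j). *)
Lemma net_point_inj (s : 'I_d -> nat) v w : (forall j, s j <= M)%N ->
  (n <= \sum_j s j)%N -> same_cell b M s (net_point v) (net_point w) -> v = w.
Proof.
(* Only [n] digits come from the polynomial; levels beyond [n] are cut to [n]. *)
move=> sM ns vw; pose u j := minn (s j) n.
have {}vw : same_cell b M u (net_point v) (net_point w).
  by apply: (same_cell_coarser _ _ b1 _ _ _ _ _ vw) => j; rewrite geq_minl sM.
pose p := rVpoly v - rVpoly w.
have pu j : ('X - (node j)%:P) ^+ u j %| p.
  apply: dvdp_shifted_coefs => i iu; rewrite comp_polyB coefB.
  apply/eqP; rewrite subr_eq0; apply/eqP/val_inj.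
  have un : (u j <= n)%N by rewrite geq_minr.
  have := vw j; rewrite /net_point.
  have -> : (M - u j = (M - n) + (n - u j))%N by lia.
  rewrite expnD !divnMA !mulnK ?expn_gt0 ?(ltnW b1)//.
  rewrite !(digval_div _ b1 _ _ _ (net_digit_lt _ j) un).
  by move=> /(digval_inj _ b1 _ _ _ (net_digit_lt v j) (net_digit_lt w j)); apply.
(* If [p] were nonzero, its degree below [n] would force [\sum_j u j < n]. Then no level was cut, so
   [u = s], against [n <= \sum_j s j]. *)
have := prod_XsubC_exp_dvdp _ _ _ (index_enum_uniq _) pu.
have [p0 _|pn0 /(dvdp_leq pn0)] := eqVneq p 0.
  by apply: (can_inj rVpolyK); apply/eqP; rewrite -subr_eq0 -/p p0.
rewrite size_prod; last by move=> j _; rewrite expf_neq0// polyXsubC_eq0.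
under eq_bigr do rewrite size_exp_XsubC -addn1.
rewrite big_split/= sum1_card -addSn addnK => sp.
have pn : (size p <= n)%N.
  by rewrite (leq_trans (size_polyD _ _))// size_polyN geq_max !size_poly.
have un : (\sum_j u j < n)%N by rewrite (leq_trans sp).
have us : forall j, u j = s j.
  move=> j; rewrite /u; apply/minn_idPl; rewrite leqNgt; apply/negP => nsj.
  have : (u j < n)%N.
    apply: leq_ltn_trans un; rewrite (bigD1 j)//=; exact: leq_addr.
  by rewrite /u (minn_idPr (ltnW nsj)) ltnn.
by move: un; rewrite (eq_bigr s) => [|j _]; rewrite ?us// ltnNge ns.
Qed.

End polynomial_net.

(** * Summation over pairs of blocks *)

Section hyperbolic_tail.
Context {R : realType}.

Lemma sum_ffun_recl (J : finType) D (F : {ffun 'I_D.+1 -> J} -> R) :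
  \sum_s F s =
  \sum_j \sum_(t : {ffun 'I_D -> J}) F [ffun i => oapp t j (unlift ord0 i)].
Proof.
rewrite pair_big/=.
pose cons (p : J * {ffun 'I_D -> J}) : {ffun 'I_D.+1 -> J} :=
  [ffun i => oapp p.2 p.1 (unlift ord0 i)].
pose uncons (s : {ffun 'I_D.+1 -> J}) := (s ord0, [ffun i => s (lift ord0 i)]).
have consK : cancel cons uncons.
  move=> [j t]; rewrite /uncons /cons ffunE unlift_none/=; congr pair.
  by apply/ffunP => i; rewrite !ffunE liftK.
have unconsK : cancel uncons cons.
  move=> s; apply/ffunP => i; rewrite ffunE.
  by case: unliftP => [k ->|->] /=; rewrite ?ffunE.
by rewrite (reindex cons)//; exists uncons => s _.
Qed.

Lemma sum_ffun_pair (I J K : finType) (F : {ffun I -> J} -> {ffun I -> K} -> R) :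
  \sum_s \sum_t F s t =
  \sum_(p : {ffun I -> J * K}) F [ffun i => (p i).1] [ffun i => (p i).2].
Proof.
rewrite pair_big/=.
pose split (p : {ffun I -> J * K}) := ([ffun i => (p i).1], [ffun i => (p i).2]).
pose join (q : {ffun I -> J} * {ffun I -> K}) := [ffun i => (q.1 i, q.2 i)].
rewrite (reindex split)//; exists join => [p _|[s t] _].
  by apply/ffunP => i; rewrite !ffunE; case: (p i).
by congr pair; apply/ffunP => i; rewrite !ffunE.
Qed.

(* The recursion comes from splitting off the first coordinate in
   [product_tail]. *)
Fixpoint tail_const (c : R) D : R :=
  if D is D'.+1 then c * tail_const c D' + c ^+ D'.+2 else c.

(** Induction on the dimension. If the first height [h j] is at most [n], the others must exceed
    [n - h j], and summing the inductive bound over [j] costs one factor [n.+1]. If [h j > n], the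
    others are unrestricted and their total weight is at most a power of [c]. *)
Lemma product_tail (J : finType) (w : J -> R) (h : J -> nat) (beta c : R) D n :
  0 <= beta -> 0 <= c -> (forall j, 0 <= w j) ->
  (forall n, \sum_(j | (h j <= n)%N) w j * beta ^+ (n - h j) <=
     c * n.+1%:R * beta ^+ n) ->
  (forall n, \sum_(j | (n < h j)%N) w j <= c * beta ^+ n) ->
  \sum_j w j <= c ->
  \sum_(s : {ffun 'I_D.+1 -> J} | (n < \sum_i h (s i))%N) \prod_i w (s i) <=
    tail_const c D * n.+1%:R ^+ D * beta ^+ n.
Proof.
move=> beta0 c0 w0 head tail total.
have C0 D' : 0 <= tail_const c D'.
  by elim: D' => [|D' IH] /=; [|apply: addr_ge0; [exact: mulr_ge0|exact: exprn_ge0]].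
elim: D n => [|D IH] n.
  rewrite big_mkcond sum_ffun_recl/= mulr1; apply: le_trans (tail n).
  rewrite [leRHS]big_mkcond; apply: ler_sum => j _.
  rewrite (big_pred1 [ffun i : 'I_0 => j]); last first.
    by move=> t; apply/esym/eqP/ffunP; case.
  by rewrite !big_ord1 ffunE unlift_none.
rewrite big_mkcond sum_ffun_recl/=.
pose tl n := \sum_(t : {ffun 'I_D.+1 -> J} | (n < \sum_i h (t i))%N) \prod_i w (t i).
have step j : \sum_(t : {ffun 'I_D.+1 -> J})
    (if (n < \sum_i h ([ffun i => oapp t j (unlift ord0 i)] i))%N
     then \prod_i w ([ffun i => oapp t j (unlift ord0 i)] i) else 0) <=
    (if (h j <= n)%N then w j * tl (n - h j)%N else 0) +
    (if (n < h j)%N then w j * c ^+ D.+1 else 0).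
  under eq_bigr => t _.
    rewrite big_ord_recl [X in if _ then X else _]big_ord_recl !ffunE unlift_none/=.
    under eq_bigr do rewrite ffunE liftK/=.
    under [X in _ * X]eq_bigr do rewrite ffunE liftK/=.
    over.
  case: leqP => jn /=.
    rewrite addr0 /tl mulr_sumr [leRHS]big_mkcond/=; apply: ler_sum => t _.
    by rewrite -ltn_subLR//; case: ifP => //; rewrite mulr0.
  rewrite add0r; under eq_bigr do rewrite (leq_trans jn (leq_addr _ _)).
  rewrite -mulr_sumr ler_wpM2l// -(bigA_distr_bigA (fun=> w))/= prodr_const card_ord.
  by rewrite lerXn2r ?nnegrE ?sumr_ge0.
apply: (le_trans (ler_sum _ (fun j _ => step j))).
rewrite big_split/= -!big_mkcond/= 2!mulrDl; apply: lerD; last first.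
  rewrite -mulr_suml mulrC [in leRHS]exprSr -!mulrA ler_wpM2l ?exprn_ge0//.
  apply: (le_trans (tail n)); rewrite ler_wpM2l// ler_peMl ?exprn_ge0//.
  by rewrite exprn_ege1// ler1n.
apply: (@le_trans _ _ (\sum_(j | (h j <= n)%N)
    (tail_const c D * n.+1%:R ^+ D) * (w j * beta ^+ (n - h j)))).
  apply: ler_sum => j jn; rewrite mulrCA ler_wpM2l//.
  apply: (le_trans (IH _)); rewrite ler_wpM2r ?exprn_ge0// ler_wpM2l//.
  by rewrite lerXn2r ?nnegrE// ler_nat ltnS leq_subr.
rewrite -mulr_sumr; apply: (@le_trans _ _
  (tail_const c D * n.+1%:R ^+ D * (c * n.+1%:R * beta ^+ n))).
  by rewrite ler_wpM2l// mulr_ge0// exprn_ge0.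
by rewrite exprSr le_eqVlt; apply/orP; left; apply/eqP; ring.
Qed.

Lemma sum_geometric_le (beta : R) m : 0 <= beta < 1 ->
  \sum_(s < m) beta ^+ s <= (1 - beta)^-1.
Proof.
move=> /andP[beta0 beta1]; have b1 : 0 < 1 - beta by rewrite subr_gt0.
rewrite -div1r ler_pdivlMr// mulrC.
have -> : (1 - beta) * \sum_(s < m) beta ^+ s = 1 - beta ^+ m.
  by rewrite -[in RHS](expr1n _ m) subrXX; congr (_ * _);
    apply: eq_bigr => i _; rewrite expr1n mul1r.
by rewrite gerBl exprn_ge0.
Qed.

Lemma sum_geometric_tail_le (beta : R) m n : 0 <= beta < 1 ->
  \sum_(s < m | (n < s)%N) beta ^+ s <= (1 - beta)^-1 * beta ^+ n.
Proof.
move=> beta01; have /andP[beta0 beta1] := beta01.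
apply: (@le_trans _ _ (\sum_(s < m | (n <= s)%N) beta ^+ s)).
  rewrite big_mkcond [leRHS]big_mkcond; apply: ler_sum => s _.
  by case: ltngtP => // _; rewrite exprn_ge0.
rewrite -(big_geq_mkord n m xpredT (fun s => beta ^+ s)) -{1}[n]add0n big_addn big_mkord.
under eq_bigr do rewrite exprD.
by rewrite -mulr_suml ler_wpM2r ?exprn_ge0// sum_geometric_le.
Qed.

Lemma sum_one_le K n : \sum_(s < K | (s <= n)%N) 1 <= n.+1%:R :> R.
Proof.
suff -> : \sum_(s < K | (s <= n)%N) 1 = (minn K n.+1)%:R :> R.
  by rewrite ler_nat geq_minr.
rewrite big_mkcond; elim: K => [|K IH]; first by rewrite big_ord0 min0n.
rewrite big_ord_recr/= IH; case: ifP => Kn; first by rewrite natr1; congr (_%:R); lia.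
by rewrite addr0; congr (_%:R); lia.
Qed.

(** A pair of multi-indices is one multi-index of pairs, with height [maxn] and weight
    [beta ^+ (s + t)] in each coordinate. With [g = (1 - beta)^-1], the three one-dimensional sums
    need the constants [2 * g], [2 * g ^+ 2] and [g ^+ 2], all covered by [2 * (g + g ^+ 2)]. *)
Lemma hyperbolic_pairs_tail (beta : R) K D n : 0 <= beta < 1 ->
  \sum_(s : {ffun 'I_D.+1 -> 'I_K}) \sum_(t : {ffun 'I_D.+1 -> 'I_K})
    (if (n < \sum_i maxn (s i) (t i))%N then beta ^+ (\sum_i s i + \sum_i t i) else 0)
  <= tail_const (2 * ((1 - beta)^-1 + (1 - beta)^-1 ^+ 2)) D * n.+1%:R ^+ D * beta ^+ n.
Proof.
move=> beta01; have /andP[beta0 beta1] := beta01.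
have g0 : 0 <= (1 - beta)^-1 by rewrite invr_ge0 subr_ge0 ltW.
rewrite sum_ffun_pair.
pose h (p : 'I_K * 'I_K) := maxn p.1 p.2.
pose w (p : 'I_K * 'I_K) := beta ^+ (p.1 + p.2).
have -> : \sum_(p : {ffun 'I_D.+1 -> 'I_K * 'I_K})
    (if (n < \sum_i maxn ([ffun i => (p i).1] i) ([ffun i => (p i).2] i))%N then
     beta ^+ (\sum_i ([ffun i => (p i).1] i : 'I_K) + \sum_i ([ffun i => (p i).2] i : 'I_K)) else 0) =
    \sum_(p : {ffun 'I_D.+1 -> 'I_K * 'I_K} | (n < \sum_i h (p i))%N) \prod_i w (p i).
  rewrite [RHS]big_mkcond; apply: eq_bigr => p _.
  rewrite -big_split/= -expr_sum.
  under eq_bigr do rewrite !ffunE.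
  by under [in beta ^+ _]eq_bigr do rewrite !ffunE.
set g := (1 - beta)^-1 in g0 *.
apply: product_tail => //.
- by rewrite mulr_ge0// addr_ge0// exprn_ge0.
- by move=> j; rewrite exprn_ge0.
- move=> {}n; rewrite -(pair_big_dep xpredT (fun s t : 'I_K => maxn s t <= n)%N
    (fun s t : 'I_K => beta ^+ (s + t)%N * beta ^+ (n - maxn s t)%N))/=.
  apply: (@le_trans _ _ (\sum_(s < K | (s <= n)%N) \sum_(t < K | (t <= n)%N)
      (beta ^+ s * beta ^+ n + beta ^+ t * beta ^+ n))).
    rewrite [leRHS]big_mkcond; apply: ler_sum => s _.
    case: (leqP s n) => sn; last first.
      by rewrite big_pred0// => t; rewrite geq_max leqNgt sn.
    under eq_bigl do rewrite geq_max sn/=.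
    apply: ler_sum => t tn; rewrite -!exprD.
    (* The exponent is [n + minn s t], so the term equals one of the two summands on the right. *)
    case: (leqP s t) => st.
      have -> : (s + t + (n - t) = s + n)%N by lia.
      by rewrite lerDl exprn_ge0.
    have -> : (s + t + (n - s) = t + n)%N by lia.
    by rewrite lerDr exprn_ge0.
  pose A : R := \sum_(s < K | (s <= n)%N) 1.
  pose G : R := \sum_(s < K | (s <= n)%N) beta ^+ s.
  have A0 : 0 <= A by rewrite sumr_ge0.
  have Ale : A <= n.+1%:R by exact: sum_one_le.
  have Gle : G <= g.
    apply: le_trans (sum_geometric_le _ K beta01); rewrite [leLHS]big_mkcond.
    by apply: ler_sum => s _; case: ifP => //; rewrite exprn_ge0.
  rewrite (eq_bigr (fun s : 'I_K => beta ^+ s * (beta ^+ n * A) + G * beta ^+ n * 1)).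
    rewrite big_split/= -mulr_suml -mulr_sumr -/G -/A.
    have -> : G * (beta ^+ n * A) + G * beta ^+ n * A = 2 * G * A * beta ^+ n by ring.
    rewrite ler_wpM2r ?exprn_ge0// ler_pM ?mulr_ge0//; first by rewrite sumr_ge0// => s _; rewrite exprn_ge0.
    by rewrite ler_wpM2l// (le_trans Gle)// lerDl exprn_ge0.
  move=> s _; rewrite big_split/= mulr1 /G mulr_suml; congr (_ + _).
  by rewrite mulrA /A mulr_sumr; apply: eq_bigr => t _; rewrite mulr1.
- move=> {}n; apply: (@le_trans _ _ (\sum_(s < K) \sum_(t < K)
      ((if (n < s)%N then beta ^+ s else 0) * beta ^+ t +
       beta ^+ s * (if (n < t)%N then beta ^+ t else 0)))).
    rewrite big_mkcond/= -(pair_big xpredT xpredT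
      (fun s t : 'I_K => if (n < h (s, t))%N then w (s, t) else 0))/=.
    apply: ler_sum => s _; apply: ler_sum => t _; rewrite /h /w/= leq_max exprD.
    have st0 : 0 <= beta ^+ s * beta ^+ t by rewrite mulr_ge0 ?exprn_ge0.
    by case: (ltnP n s) => _; case: (ltnP n t) => _ /=; rewrite ?mul0r ?mulr0 ?addr0 ?add0r ?lerDl.
  under eq_bigr do rewrite big_split/= -!mulr_sumr.
  rewrite big_split/= -!mulr_suml -!big_mkcond/=.
  set S := \sum_(t < K) beta ^+ t; set T := \sum_(s < K | _) beta ^+ s.
  have -> : T * S + S * T = 2 * (S * T) by ring.
  rewrite -mulrA ler_wpM2l//.
  apply: (@le_trans _ _ (g * (g * beta ^+ n))).
    rewrite ler_pM//.
    + by rewrite sumr_ge0// => s _; rewrite exprn_ge0.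
    + by rewrite sumr_ge0// => s _; rewrite exprn_ge0.
    + exact: sum_geometric_le.
    + exact: sum_geometric_tail_le.
  by rewrite mulrA -expr2 ler_wpM2r ?exprn_ge0// lerDr.
- rewrite -(pair_big xpredT xpredT (fun s t : 'I_K => w (s, t)))/=.
  under eq_bigr do (under eq_bigr do rewrite /w/= exprD; rewrite -mulr_sumr).
  rewrite -mulr_suml; apply: (@le_trans _ _ (g * g)).
    by rewrite ler_pM ?sum_geometric_le ?sumr_ge0// => s _; rewrite exprn_ge0.
  rewrite -expr2; have := exprn_ge0 2 g0; move: (g ^+ 2) g0 => v; lra.
Qed.

End hyperbolic_tail.

(* After scaling to A = B = 1, the inequality x y <= 1 + x^q + y^q does the work
   of Hoelder's inequality. *)
Lemma sum_mul_le {R : realType} (I : finType) (g h : I -> R) (q A B : R) :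
  2 < q -> 0 < A -> 0 < B ->
  \sum_i `|g i| `^ q <= #|I|%:R * A `^ q ->
  \sum_i `|h i| `^ q <= #|I|%:R * B `^ q ->
  \sum_i `|g i * h i| <= 3 * #|I|%:R * (A * B).
Proof.
move=> q2 A0 B0 gA hB.
have sqr_le (x : R) : 0 <= x -> x ^+ 2 <= 1 + x `^ q.
  move=> x0; have [x1|/ltW x1] := lerP x 1.
    by rewrite (le_trans (_ : _ <= 1))// ?lerDl ?powR_ge0// exprn_ile1.
  by rewrite -powR_mulrn// (le_trans (ler_powR _ (ltW q2)))// lerDr.
have scaled (x a : R) : 0 < a -> (`|x| / a) `^ q = `|x| `^ q / a `^ q.
  by move=> a0; rewrite powRM ?invr_ge0 ?(ltW a0)// -[a^-1]powR_inv1 ?(ltW a0)//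
    -powRrM mulN1r powRN.
have pointwise i : `|g i * h i| <=
    A * B * (1 + `|g i| `^ q / A `^ q + `|h i| `^ q / B `^ q).
  rewrite -!scaled// normrM; set x := `|g i| / A; set y := `|h i| / B.
  have x0 : 0 <= x by rewrite divr_ge0 ?(ltW A0).
  have y0 : 0 <= y by rewrite divr_ge0 ?(ltW B0).
  have -> : `|g i| * `|h i| = A * B * (x * y).
    by rewrite /x /y; field; rewrite !gt_eqF.
  rewrite ler_pM2l ?mulr_gt0//.
  have := sqr_le x x0; have := sqr_le y y0; have := sqr_ge0 (x - y).
  have := powR_ge0 x q; have := powR_ge0 y q.
  move: (x `^ q) (y `^ q) => u v *; nra.
apply: (le_trans (ler_sum _ (fun i _ => pointwise i))).
rewrite -mulr_sumr !big_split/= -!mulr_suml sumr_const.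
rewrite [leRHS]mulrC ler_pM2l ?mulr_gt0//.
have -> : 3 * #|I|%:R = #|I|%:R + #|I|%:R + #|I|%:R :> R by ring.
by rewrite !lerD ?ler_pdivrMr ?powR_gt0.
Qed.

(** * Error of a net for grid functions with decaying blocks *)

Section net_error.
Context {R : realType} (b D n M K : nat) (b_pr : prime b) (db : (D.+1 <= b)%N).
Context (nM : (n <= M)%N) (KM : (K <= M)%N).
Local Notation d := D.+1.
Context (phi : ('I_d -> nat) -> R) (q A rho gam : R).
Context (q2 : 2 < q) (A0 : 0 < A) (rho0 : 0 < rho) (gam1 : 1 <= gam)
  (gamq : gam `^ q = b%:R) (rg1 : rho * gam < 1).
Local Notation blk s := (block b M s (enum 'I_d) phi).
Context (blkq : forall s : 'I_d -> nat, (forall j, s j <= K)%N ->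
  gsum (b ^ M) (fun x => `|blk s x| `^ q) <=
  (b ^ M)%:R ^+ d * (A * rho ^+ \sum_j s j) `^ q).
Implicit Types (s t : 'I_d -> nat).

Local Notation net := 'rV['F_b]_n.
Local Notation pt := (@net_point b d n M).

Let b1 : (1 < b)%N := prime_gt1 b_pr.
Let b0 k : 0 < (b ^ k)%:R :> R.
Proof. by rewrite ltr0n expn_gt0 (ltnW b1). Qed.
Let gam0 : 0 < gam. Proof. exact: lt_le_trans gam1. Qed.
Let ptM (P : net) j : (pt P j < b ^ M)%N := net_point_lt b d n M b_pr nM P j.

Lemma expn_sum_subn s : (forall j, s j <= M)%N ->
  (b ^ (\sum_j (M - s j)) * b ^ (\sum_j s j))%N = (b ^ (M * d))%N.
Proof.
move=> sM; rewrite -expnD -big_split/= (eq_bigr (fun=> M)); last first.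
  by move=> j _; rewrite subnK.
by rewrite sum_nat_const card_ord mulnC.
Qed.

(** The missing [n - \sum_j u j] levels are added in coordinate [ord0]. The refined cells have
    volume exactly [b^-n], hence contain one net point each. *)
Lemma net_exact u (g : ('I_d -> nat) -> R) : leveled b M u g -> (\sum_j u j <= n)%N ->
  (b ^ n)%:R^-1 * \sum_(P : net) g (pt P) = (b ^ M)%:R ^- d * gsum (b ^ M) g.
Proof.
move=> ug un; pose s := upd u ord0 (u ord0 + (n - \sum_j u j)).
have us j : (u j <= s j)%N by rewrite /s /upd; case: eqP => // ->; rewrite leq_addr.
have sn : (\sum_j s j = n)%N.
  rewrite (bigD1 ord0)//= /s upd_same (eq_bigr u) => [|j j0]; last first.
    by rewrite upd_other// eq_sym.
  by move: un; rewrite (bigD1 ord0)//=; lia.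
have sM j : (s j <= M)%N.
  by rewrite (leq_trans _ nM)// -sn (bigD1 j)//= leq_addr.
have sg : leveled b M s g.
  by apply: (leveled_coarser _ _ b1 _ _ _ _ ug) => j; rewrite us sM.
rewrite -(@sum_pt_exact R d b M b1 net pt ptM s g)//; last first.
- by move=> P Q; apply: net_point_inj => //; rewrite sn.
- by rewrite card_net// sn.
rewrite mulrA; congr (_ * _); rewrite -natrX -expnM -(expn_sum_subn s sM) sn natrM.
by rewrite invfM mulrAC mulVf ?mul1r// gt_eqF.
Qed.

(* The truncated exponent expresses that the loss gam = b^(1/q) per level only
   occurs beyond level n. *)
Definition net_bound s : R := A * rho ^+ (\sum_j s j) * gam ^+ (\sum_j s j - n).

(** Up to level [n] the net mean of [|blk s| ^ q] is exact. Beyond it, the mean grows by at most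
    [b ^ (\sum_j s j - n)], the [q]-th power of the loss in [net_bound]. *)
Lemma block_net_powR_le s : (forall j, s j <= K)%N ->
  \sum_(P : net) `|blk s (pt P)| `^ q <= #|{: net}|%:R * net_bound s `^ q.
Proof.
move=> sK; rewrite card_net// /net_bound.
have sM j : (s j <= M)%N by rewrite (leq_trans (sK j)).
have lev : leveled b M s (fun x => `|blk s x| `^ q).
  by move=> x y xy; rewrite (leveled_block b M b1 s phi sM x y xy).
have Ar0 : 0 <= A * rho ^+ (\sum_j s j) by rewrite mulr_ge0 ?exprn_ge0 ?ltW.
have [sn|/ltnW sn] := leqP (\sum_j s j) n.
  have := net_exact _ _ lev sn => /(congr1 (fun v => (b ^ n)%:R * v)).
  rewrite mulVKf ?gt_eqF// => ->; rewrite ler_pM2l// mulrC ler_pdivrMr ?exprn_gt0//.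
  have -> : (\sum_j s j - n = 0)%N by apply/eqP; rewrite subn_eq0.
  by rewrite expr0 mulr1 mulrC; exact: blkq.
have := @sum_pt_le R d b M b1 net pt ptM s _ sM lev (fun x => powR_ge0 _ _).
move=> /(_ (fun P Q => net_point_inj b d n M b_pr db nM s P Q sM sn)) H.
have := le_trans H (blkq _ sK); rewrite -natrX -expnM -(expn_sum_subn s sM) natrM.
rewrite -mulrA ler_pM2l// => /le_trans; apply.
rewrite [in leRHS]powRM ?exprn_ge0 ?(ltW gam0)// mulrCA [leLHS]mulrC ler_wpM2l ?powR_ge0//.
rewrite -powR_mulrn ?(ltW gam0)// -powRrM (mulrC _ q) powRrM gamq powR_mulrn// -natrX -natrM.
by rewrite -expnD subnKC.
Qed.

Definition net_err (F : ('I_d -> nat) -> R) : R :=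
  (b ^ M)%:R ^- d * gsum (b ^ M) F - (b ^ n)%:R^-1 * \sum_(P : net) F (pt P).

(** The product is constant on cells of level [maxn (s j) (t j)], which settles the exact case.
    Otherwise grid and net means are bounded separately, each with constant 3. Since [n <= S + T],
    the right side is [6 * A ^+ 2 * rho ^+ (S + T) * gam ^+ (S + T - n)], and its exponent of [gam]
    dominates [(S - n) + (T - n)]. *)
Lemma net_err_pair s t : (forall j, s j <= K)%N -> (forall j, t j <= K)%N ->
  `|net_err (fun x => blk s x * blk t x)| <=
  if (n < \sum_j maxn (s j) (t j))%N
  then 6 * A ^+ 2 * gam ^- n * (rho * gam) ^+ (\sum_j s j + \sum_j t j) else 0.
Proof.
move=> sK tK; case: leqP => [stn|nst].
  have stM j : (maxn (s j) (t j) <= M)%N by rewrite geq_max !(leq_trans _ KM).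
  have sM j : (s j <= M)%N by rewrite (leq_trans (sK j)).
  have tM j : (t j <= M)%N by rewrite (leq_trans (tK j)).
  have lev : leveled b M (fun j => maxn (s j) (t j)) (fun x => blk s x * blk t x).
    move=> x y xy; congr (_ * _); [apply: (leveled_block b M b1 s phi)|
      apply: (leveled_block b M b1 t phi)] => //.
      by apply: (same_cell_coarser _ _ b1 _ _ _ _ _ xy) => j; rewrite leq_maxl stM.
    by apply: (same_cell_coarser _ _ b1 _ _ _ _ _ xy) => j; rewrite leq_maxr stM.
  by rewrite /net_err -(net_exact _ _ lev stn) subrr normr0.
set S := (\sum_j s j)%N; set T := (\sum_j t j)%N.
have nST : (n <= S + T)%N.
  rewrite (leq_trans (ltnW nst))// /S /T -big_split/=.
  by apply: leq_sum => j _; rewrite geq_max leq_addr leq_addl.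
have cardG : #|{: {ffun 'I_d -> 'I_(b ^ M)}}| = ((b ^ M) ^ d)%N.
  by rewrite card_ffun !card_ord.
have Ar (k : nat) : 0 < A * rho ^+ k by rewrite mulr_gt0 ?exprn_gt0.
have grid_le : (b ^ M)%:R ^- d * gsum (b ^ M) (fun x => `|blk s x * blk t x|) <=
    3 * ((A * rho ^+ S) * (A * rho ^+ T)).
  rewrite mulrC ler_pdivrMr ?exprn_gt0// mulrAC -natrX -cardG.
  apply: (sum_mul_le _ _ _ q) => //.
    by rewrite cardG natrX; exact: blkq.
  by rewrite cardG natrX; exact: blkq.
have net_le : (b ^ n)%:R^-1 * \sum_(P : net) `|blk s (pt P) * blk t (pt P)| <=
    3 * (net_bound s * net_bound t).
  rewrite mulrC ler_pdivrMr// mulrAC -[X in _ <= _ * X%:R * _](card_net b n b_pr).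
  by apply: (sum_mul_le _ _ _ q) => //; rewrite ?mulr_gt0 ?exprn_gt0//;
    exact: block_net_powR_le.
rewrite /net_err (le_trans (ler_normB _ _))//.
apply: (@le_trans _ _ (3 * (A * rho ^+ S * (A * rho ^+ T)) +
    3 * (net_bound s * net_bound t))).
  apply: lerD; rewrite normrM ger0_norm ?invr_ge0 ?exprn_ge0//.
    apply: le_trans grid_le; rewrite ler_pM2l ?invr_gt0 ?exprn_gt0//.
    exact: ler_norm_sum.
  apply: le_trans net_le; rewrite ler_pM2l ?invr_gt0//.
  exact: ler_norm_sum.
have -> : 6 * A ^+ 2 * gam ^- n * (rho * gam) ^+ (S + T) =
    3 * (A ^+ 2 * rho ^+ (S + T) * gam ^+ (S + T - n)) +
    3 * (A ^+ 2 * rho ^+ (S + T) * gam ^+ (S + T - n)).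
  rewrite exprMn -{2}(subnK nST) (exprD gam).
  by field; rewrite expf_neq0 ?gt_eqF.
have AA0 : 0 <= A ^+ 2 * rho ^+ (S + T) by rewrite mulr_ge0 ?exprn_ge0 ?ltW.
apply: lerD; rewrite ler_pM2l//.
  rewrite [leLHS](_ : _ = A ^+ 2 * rho ^+ (S + T) * 1); last by rewrite exprD; ring.
  by rewrite ler_wpM2l// exprn_ege1.
rewrite [leLHS](_ : _ = A ^+ 2 * rho ^+ (S + T) * gam ^+ ((S - n) + (T - n))).
  by rewrite ler_wpM2l// ler_weXn2l//; lia.
by rewrite /net_bound -/S -/T !exprD; ring.
Qed.

(** The tail over pairs is taken with ratio [rho * gam]; the factor [gam ^- n] of each pair turns
    [(rho * gam) ^+ n] into [rho ^+ n]. *)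
Lemma net_err_coarse :
  `|net_err (fun x => coarse b M K (enum 'I_d) phi x ^+ 2)| <=
  6 * A ^+ 2 *
  tail_const (2 * ((1 - rho * gam)^-1 + (1 - rho * gam)^-1 ^+ 2)) D *
  n.+1%:R ^+ D * rho ^+ n.
Proof.
pose I := {ffun 'I_d -> 'I_K.+1}.
have sqE x : coarse b M K (enum 'I_d) phi x ^+ 2 =
    \sum_(s : I) \sum_(t : I) blk (fun j => s j) x * blk (fun j => t j) x.
  rewrite expr2 -sum_block /gsum mulr_suml; apply: eq_bigr => s _.
  by rewrite mulr_sumr.
have -> : net_err (fun x => coarse b M K (enum 'I_d) phi x ^+ 2) =
    \sum_(s : I) \sum_(t : I) net_err (fun x => blk (fun j => s j) x * blk (fun j => t j) x).
  rewrite /net_err /gsum; under eq_bigr do rewrite sqE.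
  under [X in _ - _ * X]eq_bigr do rewrite sqE.
  rewrite exchange_big [X in _ - _ * X]exchange_big/= !mulr_sumr -sumrB.
  apply: eq_bigr => s _.
  rewrite exchange_big [X in _ - _ * X]exchange_big/= !mulr_sumr -sumrB.
  by apply: eq_bigr => t _.
apply: (le_trans (ler_norm_sum _ _ _)).
have err_le (s : I) : `|\sum_(t : I) net_err (fun x => blk (fun j => s j) x * blk (fun j => t j) x)| <=
    \sum_(t : I) 6 * A ^+ 2 * gam ^- n *
    (if (n < \sum_i maxn (s i) (t i))%N then (rho * gam) ^+ (\sum_i s i + \sum_i t i) else 0).
  apply: (le_trans (ler_norm_sum _ _ _)); apply: ler_sum => t _.
  apply: le_trans (net_err_pair _ _ _ _) _; try by move=> j; rewrite -ltnS.
  by case: ifP => // _; rewrite mulr0.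
apply: le_trans; first by apply: ler_sum => s _; exact: err_le.
under eq_bigr do rewrite -mulr_sumr.
rewrite -mulr_sumr.
have rg01 : 0 <= rho * gam < 1 by rewrite rg1 andbT mulr_ge0 ?ltW.
apply: (le_trans (ler_wpM2l _ (hyperbolic_pairs_tail _ K.+1 D n rg01))).
  by rewrite !mulr_ge0 ?invr_ge0 ?exprn_ge0// ltW.
rewrite exprMn le_eqVlt; apply/orP; left; apply/eqP.
by field; rewrite expf_neq0 ?gt_eqF// subr_eq0 eq_sym lt_eqF.
Qed.

End net_error.

Local Open Scope classical_set_scope.

(** * From the torus to grids *)

Section uniform_continuity.
Context {R : realType} {d : nat}.
Implicit Types (f : 'rV[R]_d -> R) (x y : 'rV[R]_d).

Definition modulus f (delta eps : R) := forall x y,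
  (forall j, `|x ord0 j - y ord0 j| < delta) -> `|f x - f y| < eps.

Definition period_cell : set 'rV[R]_d := [set v | forall i, `[0, 2 * pi]%classic (v ord0 i)].

Lemma compact_period_cell : compact period_cell.
Proof. by apply: (@rV_compact R d (fun=> `[0, 2 * pi]%classic)) => i; exact: segment_compact. Qed.

Lemma periodicz (U V : zmodType) (f : U -> V) (T : U) : periodic f T ->
  forall (z : int) (a : U), f (a + T *~ z) = f a.
Proof.
move=> fT [n|n] a; first by rewrite -pmulrn periodicn.
by rewrite NegzE mulrNz -pmulrn -[LHS](periodicn fT n.+1) subrK.
Qed.

Lemma exists_period_shift f : torus_periodic f -> forall x, exists2 z,
  period_cell (x - z) & forall y, f (y - z) = f y.
Proof.
move=> fper x.
(* Coordinates are treated one at a time; [z] vanishes in those still untreated, so the shifts do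
   not interfere. *)
suff [z [zin _ zf]] : exists z, [/\ forall j, j \in enum 'I_d ->
      `[0, 2 * pi]%classic ((x - z) ord0 j),
    forall j, j \notin enum 'I_d -> z ord0 j = 0 & forall y, f (y - z) = f y].
  by exists z => // j; apply: zin; rewrite mem_enum.
elim: (enum 'I_d) (enum_uniq 'I_d) => [_|j js IH /= /andP[jjs /IH[z [zin zout zf]]]].
  by exists 0; split=> [//|j _|y]; rewrite ?mxE ?subr0.
have p0 := @two_pi_gt0 R; pose k := Num.floor (x ord0 j / (2 * pi)).
exists (z + ((2 * pi) *: delta_mx ord0 j) *~ k); split => [i|i|y].
- rewrite inE !mxE -scaler_int !mxE ?eqxx/= => /predU1P[->|ijs].
    rewrite zout// add0r eqxx mulr1 /= in_itv/=.
    have := floor_le (x ord0 j / (2 * pi)); have := floorD1_gt (x ord0 j / (2 * pi)).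
    rewrite -/k intrD ltr_pdivrMr// ler_pdivlMr// => h1 h2.
    by apply/andP; split; lra.
  have -> : (i == j) = false by apply/negbTE; apply: contraNneq jjs => <-.
  by rewrite mulr0 mulr0 addr0; have := zin _ ijs; rewrite !mxE.
- rewrite inE negb_or => /andP[ij ijs]; rewrite !mxE -scaler_int !mxE eqxx/=.
  by rewrite (negPf ij) zout// !mulr0 addr0.
- by rewrite opprD addrA -mulrNz (periodicz _ _ _ _ (fper j)) zf.
Qed.

(** Heine-Cantor on the closed period cell. Only [x] is moved into the cell; [y] may leave it, so
    the covered property quantifies over all [y]. *)
Lemma periodic_modulus f : continuous f -> torus_periodic f ->
  forall eps, 0 < eps -> exists2 delta, 0 < delta & modulus f delta eps.
Proof.
move=> fc fper eps eps0.
have := compact_period_cell; rewrite compact_near_coveringP.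
move=> /(_ R (0 : R)^'+ (fun delta x => forall y,
  (forall j, `|x ord0 j - y ord0 j| < delta) -> `|f x - f y| < eps) _) cov.
have : \forall delta \near (0 : R)^'+, period_cell `<=` (fun x => forall y,
  (forall j, `|x ord0 j - y ord0 j| < delta) -> `|f x - f y| < eps).
  apply: cov => x _.
  have e20 : 0 < eps / 2 by rewrite divr_gt0.
  have /cvgrPdist_lt/(_ _ e20) := fc x.
  move=> /nbhs_ballP[e /= e0 fe].
  have he : 0 < e / 2 by rewrite divr_gt0.
  exists (ball x (e / 2), [set t | t < e / 2]) => /=.
    by split; [exact: nbhsx_ballx|exact: nbhs_right_lt].
  move=> [x' t] /= [xx' te] y x'y.
  have close z : ball x e z -> `|f x - f z| < eps / 2 by move=> /fe.
  have bx' : ball x e x' by apply: le_ball xx'; rewrite ler_pdivrMr// ler_pMr// ler1n.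
  have bxy : ball x e y.
    split=> // i j; rewrite ord1 /ball/=; have := x'y j.
    case: xx' => _ /(_ ord0 j); rewrite /ball/= => h1 h2.
    rewrite (le_lt_trans (ler_distD (x' ord0 j) _ _))//.
    by rewrite (splitr e) ltrD// (lt_trans h2).
  rewrite (le_lt_trans (ler_distD (f x) _ _))// (splitr eps) ltrD//; last exact: close.
  by rewrite distrC close.
move=> near_cov; have : \forall delta \near (0 : R)^'+, 0 < delta by exact: nbhs_right_gt.
move=> /(filterI near_cov)/filter_ex[delta [fcell delta0]].
exists delta => // x y xy; have [z xz fz] := exists_period_shift _ fper x.
rewrite -(fz x) -(fz y); apply: fcell => // j; rewrite !mxE.
by have := xy j; congr (_ < _); congr (`|_|); ring.
Qed.

Lemma periodic_bounded f : continuous f -> torus_periodic f ->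
  exists2 B, 0 < B & forall x, `|f x| <= B.
Proof.
move=> fc fper.
have /compact_bounded : compact (f @` period_cell).
  by apply: continuous_compact (compact_period_cell); exact: continuous_subspaceT.
move=> [B [_ fB]]; exists (Num.max B 0 + 1) => [|x].
  by rewrite ltr_wpDl// le_max lexx orbT.
have [z xz fz] := exists_period_shift _ fper x; rewrite -(fz x).
by apply: fB; [rewrite ltr_pwDr// le_max lexx|exists (x - z)].
Qed.

End uniform_continuity.

Section torus_cells.
Context {R : realType}.
Local Notation RB := (measurableTypeR R).

Definition tuple_box d (a c : 'I_d -> R) : set (d.-tuple RB) :=
  [set y | forall j, a j <= tnth y j < c j].

Lemma measurable_tuple_box d (a c : 'I_d -> R) : measurable (tuple_box d a c).
Proof.
have -> : tuple_box d a c =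
    \bigcap_(j in [set: 'I_d]) ((fun y : d.-tuple RB => tnth y j) @^-1` `[a j, c j[).
  apply/seteqP; split => y /= yb j; first by move=> _ /=; rewrite in_itv/=; exact: yb.
  by have := yb j I; rewrite /= in_itv.
apply: fin_bigcap_measurable => [|j _]; first exact: finite_finset.
rewrite -[X in measurable X]setTI; apply: measurable_tnth => //.
Qed.

Lemma circle_measure_itv (a c : R) : 0 <= a -> a <= c -> c <= 2 * pi ->
  circle_measure (`[a, c[ : set RB) = ((c - a) / (2 * pi))%:E.
Proof.
move=> a0 ac cp; have p0 := @two_pi_gt0 R.
transitivity (\int[lebesgue_measure]_(x in `[a, c[) (uniform_pdf 0 (2 * pi) x)%:E)%E => //.
rewrite integral_uniform_pdf.
have sub : `[a, c[ `<=` `[0, 2 * pi].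
  by move=> x /=; rewrite !in_itv/= => /andP[ax xc]; rewrite (le_trans a0)//= ltW// (lt_le_trans xc).
rewrite setIidl// (eq_integral (fun=> (2 * pi)^-1%:E)); last first.
  by move=> x; rewrite inE => /sub/=; rewrite in_itv/= /uniform_pdf subr0 => ->.
rewrite integral_cst//= lebesgue_measure_itv/= lte_fin.
case: ltgtP ac => // [ac _|-> _]; first by rewrite -EFinB -EFinM mulrC.
by rewrite mule0 subrr mul0r.
Qed.

Lemma torus_measure_box d (a c : 'I_d -> R) :
  (forall j, [/\ 0 <= a j, a j <= c j & c j <= 2 * pi]) ->
  torus_measure d (tuple_box d a c) = (\prod_j ((c j - a j) / (2 * pi)))%:E.
Proof.
elim: d a c => [|d IH] a c ac.
  rewrite big_ord0 /= diracE mem_set//; by case.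
rewrite big_ord_recl /= /distribution /pushforward.
have -> : @tuple_cons R d @^-1` tuple_box d.+1 a c =
    `[a ord0, c ord0[ `*` tuple_box d (a \o lift ord0) (c \o lift ord0).
  apply/seteqP; split => -[z y] /=.
    move=> zy; split => [|j].
      by have := zy ord0; rewrite (tnth_nth z)/= in_itv.
    by have := zy (lift ord0 j); rewrite tnthS.
  rewrite in_itv/= => -[z0 yb] j; case: (unliftP ord0 j) => [k ->|->].
    by rewrite tnthS; exact: yb.
  by rewrite (tnth_nth z).
rewrite product_measure1E//; last exact: measurable_tuple_box.
have [a0 ac0 c0] := ac ord0.
rewrite EFinM; congr (_ * _)%E; first exact: circle_measure_itv.
by apply: IH => j; exact: ac.
Qed.

Context (d N : nat) (N0 : (0 < N)%N).
Implicit Types (x : {ffun 'I_d -> 'I_N}) (y : d.-tuple RB).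

Definition node_coord (i : nat) : R := 2 * pi * i%:R / N%:R.

Definition torus_cell x : set (d.-tuple RB) :=
  tuple_box d (fun j => node_coord (x j)) (fun j => node_coord (x j).+1).

Let N0' : 0 < N%:R :> R. Proof. by rewrite ltr0n. Qed.

Lemma ltr_node_coord i k : (node_coord i < node_coord k) = (i < k)%N.
Proof. by rewrite /node_coord ltr_pM2r ?invr_gt0// ltr_pM2l ?two_pi_gt0// ltr_nat. Qed.

Lemma measurable_torus_cell x : measurable (torus_cell x).
Proof. exact: measurable_tuple_box. Qed.

Lemma torus_measure_cell x : torus_measure d (torus_cell x) = (N%:R ^- d)%:E.
Proof.
have p0 := @two_pi_gt0 R.
rewrite torus_measure_box => [|j]; last first.
  split; first by rewrite divr_ge0// mulr_ge0// ltW.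
    by rewrite leNgt ltr_node_coord -leqNgt leqnSn.
  by rewrite ler_pdivrMr// ler_pM2l// ler_nat.
rewrite (eq_bigr (fun=> N%:R^-1)) => [|j _]; first by rewrite prodr_const card_ord exprVn.
by rewrite /node_coord -natr1; move: (2 * pi) p0 => P p0; field; rewrite !gt_eqF.
Qed.

Lemma trivIset_torus_cell : trivIset [set: {ffun 'I_d -> 'I_N}] torus_cell.
Proof.
move=> x x' _ _ [y [yx yx']]; apply/ffunP => j; apply/val_inj/eqP.
have /andP[h1 h2] := yx j; have /andP[h3 h4] := yx' j.
have := le_lt_trans h1 h4; have := le_lt_trans h3 h2.
by rewrite !ltr_node_coord !ltnS eqn_leq => -> ->.
Qed.

Let cells := \big[setU/set0]_(x <- index_enum {ffun 'I_d -> 'I_N}) torus_cell x.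

Lemma integral_cells (g : d.-tuple RB -> R) :
  measurable_fun (T := d.-tuple RB) setT g -> (forall y, 0 <= g y) ->
  (\int[torus_measure d]_(y in cells) (g y)%:E =
   \sum_x \int[torus_measure d]_(y in torus_cell x) (g y)%:E)%E.
Proof.
move=> mg g0; rewrite ge0_integral_bigsetU//.
- exact: measurable_torus_cell.
- exact: index_enum_uniq.
- by apply: sub_trivIset trivIset_torus_cell.
- by apply/measurable_EFinP; exact: measurable_funTS.
- by move=> y _; rewrite lee_fin.
Qed.

Lemma measurable_cells : measurable cells.
Proof. by apply: bigsetU_measurable => x _; exact: measurable_torus_cell. Qed.

(** That the cells exhaust the space up to a null set is read off from their total mass; no covering
    is checked. *)
Lemma torus_measure_cells : torus_measure d cells = 1%E.
Proof.
have int1 (A : set (d.-tuple RB)) : measurable A ->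
    (\int[torus_measure d]_(y in A) (cst (1 : R) y)%:E = torus_measure d A)%E.
  by move=> mA; rewrite -[RHS]mul1e -integral_cst.
rewrite -(int1 _ measurable_cells) (integral_cells (cst 1) (measurable_cst _) (fun=> ler01)).
under eq_bigr do rewrite (int1 _ (measurable_torus_cell _)) torus_measure_cell.
rewrite sumEFin sumr_const card_ffun !card_ord -[X in X%:E]mulr_natl natrX mulfV//.
by rewrite expf_neq0// gt_eqF.
Qed.

Lemma riemann_sum_le (g : d.-tuple RB -> R) (a : {ffun 'I_d -> 'I_N} -> R) :
  measurable_fun (T := d.-tuple RB) setT g -> (forall y, 0 <= g y) -> (forall x, 0 <= a x) ->
  (forall x y, torus_cell x y -> a x <= g y) ->
  ((N%:R ^- d * \sum_x a x)%:E <= \int[torus_measure d]_y (g y)%:E)%E.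
Proof.
move=> mg g0 a0 ag.
apply: (@le_trans _ _ (\int[torus_measure d]_(y in cells) (g y)%:E)%E); last first.
  apply: ge0_subset_integral => //; first exact: measurable_cells.
    exact/measurable_EFinP.
  by move=> y _; rewrite lee_fin.
rewrite integral_cells//.
rewrite mulr_sumr -sumEFin; apply: lee_sum => x _.
rewrite mulrC EFinM -(torus_measure_cell x) -integral_cst; last exact: measurable_torus_cell.
apply: ge0_le_integral => //.
- exact: measurable_torus_cell.
- by move=> y _; rewrite lee_fin.
- by apply/measurable_EFinP; exact: measurable_funTS.
- by move=> y xy; rewrite lee_fin; exact: ag.
Qed.

Lemma riemann_sum_ge (g : d.-tuple RB -> R) (a : {ffun 'I_d -> 'I_N} -> R) :
  measurable_fun (T := d.-tuple RB) setT g -> (forall y, 0 <= g y) ->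
  (forall x y, torus_cell x y -> g y <= a x) ->
  (\int[torus_measure d]_y (g y)%:E <= (N%:R ^- d * \sum_x a x)%:E)%E.
Proof.
move=> mg g0 ga.
rewrite (@ge0_negligible_integral _ _ _ _ _ (~` cells))//; last 4 first.
- by apply: measurableC; exact: measurable_cells.
- exact/measurable_EFinP.
- by move=> y _; rewrite lee_fin.
- apply: (etrans (probability_setC (torus_measure d) measurable_cells)).
  by rewrite [X in (1 - X)%E]torus_measure_cells subee.
rewrite setTD setCK integral_cells//.
rewrite mulr_sumr -sumEFin; apply: lee_sum => x _.
rewrite mulrC EFinM -(torus_measure_cell x) -integral_cst; last exact: measurable_torus_cell.
apply: ge0_le_integral => //.
- exact: measurable_torus_cell.
- by move=> y _; rewrite lee_fin.
- by apply/measurable_EFinP; exact: measurable_funTS.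
- by move=> y xy; rewrite lee_fin; exact: ga.
Qed.

End torus_cells.

Section sampling.
Context {R : realType} {d : nat}.
Local Notation RB := (measurableTypeR R).
Implicit Types (f g : 'rV[R]_d -> R).

Definition gridpt N (x : 'I_d -> nat) : 'rV[R]_d := \row_j node_coord N (x j).

Lemma gridpt_upd N x j t :
  gridpt N (upd x j (x j + t)) = gridpt N x + node_coord N t *: delta_mx ord0 j.
Proof.
apply/rowP => k; rewrite !mxE/= /upd; case: eqP => [->|] /=.
  by rewrite mulr1 /node_coord natrD mulrDr mulrDl.
by rewrite mulr0 addr0.
Qed.

(** [mixed_difference] of order 1 along a list of coordinates, which permits induction; [iter 1]
    keeps the two convertible. *)
Definition iter_difference (t : 'rV[R]_d) (js : seq 'I_d) f :=
  foldr (fun j g => iter 1 (difference (t ord0 j) j) g) f js.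

Lemma mixed_dif_sample N (t : 'I_d -> nat) js f x :
  mixed_dif t js (f \o gridpt N) x = iter_difference (gridpt N t) js f (gridpt N x).
Proof.
elim: js x => //= j js IH x; rewrite /dif /difference !IH gridpt_upd.
by rewrite [gridpt N t ord0 j]mxE.
Qed.

Lemma modulus_iter_difference t js f delta eps : modulus f delta eps ->
  modulus (iter_difference t js f) delta (2 ^+ size js * eps).
Proof.
move=> fm; elim: js => [|j js IH] /=; first by rewrite mul1r.
move=> x y xy; rewrite /difference exprS -mulrA mulr_natl mulr2n.
set u := t ord0 j *: _; set h := iter_difference t js f in IH *;
have -> : h (x + u) - h x - (h (y + u) - h y) = (h (x + u) - h (y + u)) + (h y - h x) by ring.
rewrite (le_lt_trans (ler_normD _ _))// ltrD//.
  by apply: IH => k; have := xy k; rewrite !mxE opprD addrACA subrr addr0.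
by rewrite distrC; exact: IH.
Qed.

Let shift_tuple (t : R) (j : 'I_d) (y : d.-tuple RB) : d.-tuple RB :=
  [tuple (tnth y k + t *+ (k == j))%R | k < d].

Let measurable_shift_tuple t j :
  measurable_fun (T := d.-tuple RB) (U := d.-tuple RB) setT (shift_tuple t j).
Proof.
apply/measurable_fun_tnthP => k.
have -> : (fun y : d.-tuple RB => tnth y k) \o shift_tuple t j =
    (fun y : d.-tuple RB => (tnth y k + t *+ (k == j))%R).
  by apply/funext => y; rewrite /= tnth_mktuple.
by apply: measurable_funD => //; exact: measurable_tnth.
Qed.

Lemma measurable_iter_difference t js f :
  measurable_fun (T := d.-tuple RB) setT (f \o row_of_tuple) ->
  measurable_fun (T := d.-tuple RB) setT (iter_difference t js f \o row_of_tuple).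
Proof.
move=> mf; elim: js => [//|j js IH] /=.
rewrite /difference; apply: measurable_funB => //.
have -> : (fun y : d.-tuple RB => iter_difference t js f
      (row_of_tuple y + t ord0 j *: delta_mx ord0 j)) =
    (iter_difference t js f \o row_of_tuple) \o shift_tuple (t ord0 j) j.
  apply/funext => y /=; congr (iter_difference t js f _); apply/rowP => k.
  by rewrite !mxE/= tnth_mktuple mulr_natr.
exact: (measurableT_comp IH (measurable_shift_tuple _ _)).
Qed.

Lemma cell_close N (x : {ffun 'I_d -> 'I_N}) y delta : (0 < N)%N -> 2 * pi / N%:R < delta ->
  torus_cell d N x y ->
  forall j, `|(row_of_tuple y) ord0 j - gridpt N (fun j => x j) ord0 j| < delta.
Proof.
move=> N0 Nd xy j; rewrite !mxE; have /andP[h1 h2] := xy j.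
rewrite ger0_norm ?subr_ge0//; apply: lt_trans Nd.
by move: h2; rewrite /node_coord -[((x j).+1)%:R]natr1 mulrDr mulrDl mulr1 ltrBlDl.
Qed.

(** On a cell the difference changes by at most [2 ^+ size js * eps], since every factor doubles the
    modulus. The constant [2 ^ q] separates this error from the integral. *)
Lemma gsum_difference_le N t js f q delta eps (I : R) : (0 < N)%N -> 1 < q -> 0 < eps ->
  2 * pi / N%:R < delta -> modulus f delta eps ->
  measurable_fun (T := d.-tuple RB) setT (f \o row_of_tuple) ->
  (\int[torus_measure d]_y (`|iter_difference t js f (row_of_tuple y)| `^ q)%:E <= I%:E)%E ->
  gsum N (fun x => `|iter_difference t js f (gridpt N x)| `^ q) <=
  N%:R ^+ d * (2 `^ q * (I + (2 ^+ size js * eps) `^ q)).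
Proof.
move=> N0 q1 eps0 Nd fm mf HI; have q0 : 0 < q by exact: lt_trans q1.
set G := iter_difference t js f in HI *; set e' := 2 ^+ size js * eps.
have Gm : modulus G delta e' by exact: modulus_iter_difference.
have mG : measurable_fun (T := d.-tuple RB) setT (G \o row_of_tuple).
  exact: measurable_iter_difference.
have mGq : measurable_fun (T := d.-tuple RB) setT (fun y => `|G (row_of_tuple y)| `^ q).
  apply: (measurableT_comp (measurable_powR q)).
  exact: (measurableT_comp (@normr_measurable R setT) mG).
have N0' : 0 < N%:R ^+ d :> R by rewrite exprn_gt0// ltr0n.
rewrite -ler_pdivrMl// -lee_fin.
have := @riemann_sum_le R d N N0
  (fun y => 2 `^ q * (`|G (row_of_tuple y)| `^ q + e' `^ q))
  (fun x => `|G (gridpt N (fun j => x j))| `^ q).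
have m1 : measurable_fun (T := d.-tuple RB) setT
    (fun y => `|G (row_of_tuple y)| `^ q + e' `^ q) by exact: measurable_funD.
have m2 : measurable_fun (T := d.-tuple RB) setT
    (fun y => 2 `^ q * (`|G (row_of_tuple y)| `^ q + e' `^ q)).
  by exact: measurable_funM.
move=> /(_ m2) /(_ _ _ _)/le_trans; apply.
- by move=> y; rewrite mulr_ge0 ?addr_ge0 ?powR_ge0.
- by move=> x; exact: powR_ge0.
- move=> x y xy; have := Gm _ _ (cell_close _ _ _ _ N0 Nd xy) => /ltW dG.
  have := powR_sub_le (G (row_of_tuple y)) (G (row_of_tuple y) - G (gridpt N (fun j => x j))) q q0.
  rewrite opprB addrC subrK => /le_trans; apply.
  rewrite ler_pM2l ?powR_gt0// lerD2l ge0_ler_powR ?nnegrE ?(ltW q0)//.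
  exact: le_trans dG.
under eq_integral do rewrite EFinM.
rewrite ge0_integralZl//; last 2 first.
- by have /measurable_EFinP := m1.
- by move=> y _; rewrite lee_fin addr_ge0 ?powR_ge0.
under eq_integral do rewrite EFinD.
rewrite ge0_integralD//; last 2 first.
- by have /measurable_EFinP := mGq.
- by move=> y _; rewrite lee_fin powR_ge0.
rewrite EFinM lee_pmul2l ?lte_fin ?powR_gt0// EFinD; apply: leeD => //.
rewrite integral_cst// -[leRHS]mule1 lee_pmul2l ?lte_fin ?powR_gt0 ?exprn_gt0 ?mulr_gt0 ?exprn_gt0//.
by rewrite probability_le1.
Qed.

End sampling.

(** * The error of a net and of a union of nets *)

Section sampled_blocks.
Context {R : realType} (b D : nat) (b_pr : prime b) (db : (D.+1 <= b)%N) (q r : R).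
Context (q2 : 2 < q) (qr : q^-1 < r).
Local Notation d := D.+1.
Local Notation RB := (measurableTypeR R).

Definition rho : R := b%:R `^ (- r).
Definition gam : R := b%:R `^ q^-1.
(** The shifts for a factor of level [k > 0] are shorter than a box of level [k - 1], of side
    [2 * pi * b * b^-k]; their [r]-th power is at most [reach * rho ^+ k]. *)
Definition reach : R := (2 * pi * b%:R) `^ r.
(** The [q]-th root of the losses of [block_powR_le] and [gsum_difference_le]; the summand 1 absorbs
    the Riemann sum error. *)
Definition block_const : R :=
  ((4 * 2 `^ q) ^+ d * (2 `^ q * ((reach ^+ d) `^ q + 1))) `^ q^-1.
Definition net_const : R :=
  6 * block_const ^+ 2 *
  tail_const (2 * ((1 - rho * gam)^-1 + (1 - rho * gam)^-1 ^+ 2)) D.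

Let b1 : (1 < b)%N := prime_gt1 b_pr.
Let b0 : 0 < b%:R :> R. Proof. by rewrite ltr0n (ltnW b1). Qed.
Let b1R : 1 < b%:R :> R. Proof. by rewrite ltr1n. Qed.
Let q0 : 0 < q. Proof. exact: lt_trans q2. Qed.
Let r0 : 0 < r. Proof. by apply: lt_trans qr; rewrite invr_gt0. Qed.

Lemma rho_gt0 : 0 < rho. Proof. exact: powR_gt0. Qed.

Lemma rho_le1 : rho <= 1.
Proof.
apply: (@le_trans _ _ (b%:R `^ 0)); last by rewrite powRr0.
by rewrite /rho ler_powR ?oppr_le0 ?(ltW r0)// ltW.
Qed.

Lemma gam_ge1 : 1 <= gam.
Proof.
apply: (@le_trans _ _ (b%:R `^ 0)); first by rewrite powRr0.
by rewrite /gam ler_powR ?invr_ge0 ?(ltW q0)// ltW.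
Qed.

Lemma gam_powR : gam `^ q = b%:R.
Proof. by rewrite /gam -powRrM mulVf ?gt_eqF// powRr1// ltW. Qed.

Lemma rho_gam_lt1 : rho * gam < 1.
Proof.
rewrite /rho /gam -powRD; last by rewrite (gt_eqF b0) implybT.
rewrite /powR gt_eqF// expR_lt1 nmulr_rlt0 ?ln_gt0//.
by rewrite addrC subr_lt0.
Qed.

Lemma reach_ge1 : 1 <= reach.
Proof.
rewrite /reach; apply: (@le_trans _ _ (1 `^ r)); first by rewrite powR1.
have p2 := pi_ge2 R; have b1' := ltW b1R.
by rewrite ge0_ler_powR ?nnegrE ?(ltW r0)//; nra.
Qed.

Lemma block_const_gt0 : 0 < block_const.
Proof.
rewrite powR_gt0// mulr_gt0 ?exprn_gt0 ?mulr_gt0 ?powR_gt0//.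
by rewrite ltr_wpDl ?powR_ge0.
Qed.

Lemma block_const_powR : block_const `^ q =
  (4 * 2 `^ q) ^+ d * (2 `^ q * ((reach ^+ d) `^ q + 1)).
Proof.
rewrite /block_const -powRrM mulVf ?gt_eqF// powRr1//.
by rewrite mulr_ge0 ?exprn_ge0 ?mulr_ge0 ?powR_ge0// addr_ge0 ?powR_ge0.
Qed.

Lemma node_coord_powR_le M k t : (0 < k)%N -> (k <= M)%N -> (t < b ^ (M - k.-1))%N ->
  `|node_coord (b ^ M) t| `^ r <= reach * rho ^+ k.
Proof.
case: k => // k _ kM /= tb; have p0 : 0 < 2 * pi :> R by exact: two_pi_gt0.
have bk0 j : 0 < b%:R ^+ j :> R by rewrite exprn_gt0.
have nc0 : 0 <= node_coord (R := R) (b ^ M) t by rewrite divr_ge0// mulr_ge0// ltW.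
have W0 : 0 <= 2 * pi * b%:R :> R by rewrite mulr_ge0 ?ltW.
have V0 : 0 <= (b%:R ^+ k.+1)^-1 :> R by rewrite invr_ge0 ltW.
have -> : reach * rho ^+ k.+1 = (2 * pi * b%:R * (b%:R ^+ k.+1)^-1) `^ r.
  rewrite [RHS]powRM//.
  congr (_ * _); rewrite -powR_inv1 ?(ltW (bk0 _))// -powRrM.
  rewrite -(powR_mulrn k.+1 (ltW b0)) -powRrM -(powR_mulrn k.+1 (ltW rho_gt0)).
  by rewrite /rho -powRrM; congr powR; ring.
rewrite ger0_norm// ge0_ler_powR ?nnegrE ?(ltW r0)//.
  exact: mulr_ge0.
rewrite /node_coord -!mulrA ler_pM2l// ler_pM2l ?pi_gt0// natrX ler_pdivrMr//.
have -> : b%:R * (b%:R ^+ k.+1)^-1 * b%:R ^+ M = (b ^ (M - k))%:R :> R.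
  rewrite -mulrA -{1}(subnKC kM) exprD mulKf ?gt_eqF// -exprS -natrX.
  by congr ((_ ^ _)%:R); lia.
by rewrite ler_nat ltnW.
Qed.

Context (f : 'rV[R]_d -> R).
Context (mf : measurable_fun (T := d.-tuple RB) setT (f \o row_of_tuple)).
Context (fH : forall (e : {set 'I_d}) (t : 'rV[R]_d),
  (\int[torus_measure d]_y (`|iter_difference t (enum e) f (row_of_tuple y)| `^ q)%:E
   <= ((\prod_(j in e) `|t ord0 j| `^ r) `^ q)%:E)%E).

(** The condition on [eps] puts the discretization error below [rho ^+ (d * K)], which is at most
    the decay factor of any block with levels up to [K]. *)
Lemma block_sample_powR_le K M (s : 'I_d -> nat) delta eps : (K <= M)%N ->
  (forall j, s j <= K)%N -> 0 < eps -> 2 * pi / (b ^ M)%:R < delta ->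
  modulus f delta eps -> 2 ^+ d * eps <= rho ^+ (d * K) ->
  gsum (b ^ M) (fun x => `|block b M s (enum 'I_d) (f \o gridpt (b ^ M)) x| `^ q) <=
  (b ^ M)%:R ^+ d * (block_const * rho ^+ \sum_j s j) `^ q.
Proof.
move=> KM sK eps0 Md fm epsK; set S := (\sum_j s j)%N.
have N0 : (0 < b ^ M)%N by rewrite expn_gt0 (ltnW b1).
have q1 : 1 < q by apply: lt_trans q2; rewrite ltr1n.
have rho0 := rho_gt0; have reach1 := reach_ge1.
have SdK : (S <= d * K)%N.
  rewrite -[X in (_ <= X * _)%N]card_ord -sum_nat_const.
  by apply: leq_sum => j _; exact: sK.
pose B := (b ^ M)%:R ^+ d * (2 `^ q * ((reach ^+ d) `^ q + 1) * (rho ^+ S) `^ q) : R.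
have -> : (b ^ M)%:R ^+ d * (block_const * rho ^+ S) `^ q =
    (4 * 2 `^ q) ^+ size (enum 'I_d) * B.
  rewrite size_enum_ord powRM ?exprn_ge0 ?(ltW rho0) ?(ltW block_const_gt0)//.
  by rewrite block_const_powR /B; ring.
apply: block_powR_le => //; first exact: enum_uniq.
- by rewrite !mulr_ge0 ?exprn_ge0 ?addr_ge0 ?powR_ge0.
- by move=> j; rewrite (leq_trans (sK j)).
move=> t tlt; pose e := [set j | (0 < s j)%N]%SET.
have -> : [seq j <- enum 'I_d | (0 < s j)%N] = enum e.
  by rewrite enumT; apply: eq_filter => j; rewrite -[RHS]/(j \in e) inE.
under [X in X <= _]eq_bigr do rewrite mixed_dif_sample.
apply: (le_trans (gsum_difference_le _ _ _ _ q delta eps _ N0 q1 eps0 Md fm mf (fH e _))).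
rewrite /B ler_wpM2l ?exprn_ge0// -mulrA ler_pM2l ?powR_gt0// mulrDl mul1r.
apply: lerD.
  have rd0 : 0 <= reach ^+ d by rewrite exprn_ge0// (le_trans ler01 reach1).
  have rS0 : 0 <= rho ^+ S by rewrite exprn_ge0// ltW.
  rewrite -powRM// ge0_ler_powR ?nnegrE ?(ltW q0) ?mulr_ge0//.
    by apply: prodr_ge0 => j _; exact: powR_ge0.
  have -> : reach ^+ d * rho ^+ S = \prod_j (reach * rho ^+ s j).
    by rewrite big_split/= prodr_const card_ord expr_sum.
  (* Coordinates with [s j = 0] carry no difference; as [reach >= 1], they are padded by a factor
     [reach], and the constant is independent of [s]. *)
  rewrite big_mkcond/=; apply: ler_prod => j _; rewrite inE.
  case: ifPn => [sj|]; rewrite ?powR_ge0/=.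
    by rewrite mxE node_coord_powR_le ?(leq_trans (sK j))// tlt// mem_enum.
  by rewrite -eqn0Ngt => /eqP ->; rewrite expr0 mulr1 ler01.
rewrite ge0_ler_powR ?nnegrE ?(ltW q0)//.
- by rewrite mulr_ge0 ?exprn_ge0 ?(ltW eps0).
- by rewrite exprn_ge0 ?(ltW rho0).
apply: (@le_trans _ _ (2 ^+ d * eps)).
  rewrite ler_pM2r// ler_weXn2l ?ler1n//.
  by rewrite -cardE (leq_trans (max_card _))// card_ord.
apply: (le_trans epsK); rewrite ler_wiXn2l ?rho_le1 ?(ltW rho0)//.
Qed.

End sampled_blocks.

Lemma exists_expn_small {R : realType} (b k : nat) (delta : R) : (1 < b)%N -> 0 < delta ->
  exists2 M, (k <= M)%N & 2 * pi / (b ^ M)%:R < delta.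
Proof.
move=> b1 d0; pose m := Num.bound (2 * pi / delta).
have md : 2 * pi / delta < m%:R.
  by rewrite archi_boundP// divr_ge0 ?(ltW d0)// ltW// two_pi_gt0.
exists (k + m)%N; first exact: leq_addr.
have mM : (m < b ^ (k + m))%N.
  by rewrite (leq_trans (ltn_expl m b1))// leq_exp2l// leq_addl.
rewrite ltr_pdivrMr ?ltr0n ?(leq_ltn_trans _ mM)//.
move: md; rewrite ltr_pdivrMr// [X in _ -> _ < X]mulrC => /lt_trans; apply.
by rewrite ltr_pM2r// ltr_nat.
Qed.

Section net_points.
Context {R : realType} (b D n : nat).
Local Notation d := D.+1.

Definition net_node (P : 'rV['F_b]_n) : 'rV[R]_d := gridpt (b ^ n) (net_point b d n n P).

(** The appended zero digits cancel the finer step: the nodes stay fixed while [M] is chosen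
    according to [f]. *)
Lemma gridpt_net_point M P : (1 < b)%N -> (n <= M)%N ->
  gridpt (b ^ M) (net_point b d n M P) = net_node P.
Proof.
move=> b1 nM; apply/rowP => j; rewrite !mxE /node_coord /net_point subnn expn0 muln1.
have bn0 k : (b ^ k)%:R != 0 :> R by rewrite pnatr_eq0 expn_eq0; case: b b1.
rewrite -{2}(subnKC nM) expnD !natrM.
move: (2 * pi) => T; move: (digval _ _ _)%:R => v.
by field; rewrite !bn0.
Qed.

Lemma torus_net_node P : prime b -> (d <= b)%N -> torus (net_node P).
Proof.
move=> b_pr db j; rewrite mxE /node_coord; have b1 := prime_gt1 b_pr.
have p0 := @two_pi_gt0 R.
have bn0 : 0 < (b ^ n)%:R :> R by rewrite ltr0n expn_gt0 (ltnW b1).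
apply/andP; split; first by rewrite divr_ge0// mulr_ge0// ltW.
by rewrite ltr_pdivrMr// ltr_pM2l// ltr_nat net_point_lt.
Qed.

End net_points.

Section net_integration.
Context {R : realType} (b D : nat) (b_pr : prime b) (db : (D.+1 <= b)%N) (q r : R).
Context (q2 : 2 < q) (qr : q^-1 < r).
Local Notation d := D.+1.
Local Notation RB := (measurableTypeR R).
Local Notation rho := (rho b r).
Context (f : 'rV[R]_d -> R) (fc : continuous f) (fper : torus_periodic f).
Context (mf : measurable_fun (T := d.-tuple RB) setT (f \o row_of_tuple)).
Context (fH : forall (e : {set 'I_d}) (t : 'rV[R]_d),
  (\int[torus_measure d]_y (`|iter_difference t (enum e) f (row_of_tuple y)| `^ q)%:E
   <= ((\prod_(j in e) `|t ord0 j| `^ r) `^ q)%:E)%E).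
Context (I : R) (fI : (\int[torus_measure d]_y ((f (row_of_tuple y)) ^+ 2)%:E = I%:E)%E).

Let b1 : (1 < b)%N := prime_gt1 b_pr.

Lemma sqr_close (u v B eta : R) : `|u| <= B -> `|v| <= B -> `|u - v| <= eta ->
  `|u ^+ 2 - v ^+ 2| <= 2 * B * eta.
Proof.
move=> uB vB uv; rewrite subr_sqr normrM mulrC ler_pM//.
by rewrite (le_trans (ler_normD _ _))// mulr_natl mulr2n lerD.
Qed.

Lemma riemann_sqr_close N B delta eta : (0 < N)%N -> 0 < eta -> 2 * pi / N%:R < delta ->
  modulus f delta eta -> (forall x, `|f x| <= B) ->
  `|I - N%:R ^- d * gsum N (fun x => f (gridpt N x) ^+ 2)| <= 2 * B * eta.
Proof.
move=> N0 eta0 Nd fm fB.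
have B0 : 0 <= B by exact: le_trans (fB 0).
have Be0 : 0 <= 2 * B * eta by rewrite !mulr_ge0// ltW.
have close x y : torus_cell d N x y ->
    `|f (row_of_tuple y) ^+ 2 - f (gridpt N (fun j => x j)) ^+ 2| <= 2 * B * eta.
  move=> xy; apply: sqr_close => //; apply: ltW; apply: fm.
  exact: (cell_close N x y delta N0 Nd xy).
have m2 : measurable_fun (T := d.-tuple RB) setT (fun y => f (row_of_tuple y) ^+ 2).
  exact: (measurable_funX 2 mf).
have m3 : measurable_fun (T := d.-tuple RB) setT
    (fun y => f (row_of_tuple y) ^+ 2 + 2 * B * eta).
  exact: measurable_funD.
have Nd0 : N%:R ^+ d != 0 :> R by rewrite expf_neq0// pnatr_eq0 -lt0n.
(* In both comparisons the error is added to the larger side, so that all functions stay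
   nonnegative. *)
have := @riemann_sum_le R d N N0 (fun y => f (row_of_tuple y) ^+ 2 + 2 * B * eta)
  (fun x => f (gridpt N (fun j => x j)) ^+ 2) m3.
have := @riemann_sum_ge R d N N0 (fun y => f (row_of_tuple y) ^+ 2)
  (fun x => f (gridpt N (fun j => x j)) ^+ 2 + 2 * B * eta) m2.
have -> : (\int[torus_measure d]_y (f (row_of_tuple y) ^+ 2 + 2 * B * eta)%:E =
    (I + 2 * B * eta)%:E)%E.
  under eq_integral do rewrite EFinD.
  rewrite ge0_integralD//.
  - by rewrite fI integral_cst// [X in (_ * X)%E](@probability_setT _ _ _ (torus_measure d)) mule1.
  - by move=> y _; rewrite lee_fin sqr_ge0.
  - by have /measurable_EFinP := m2.
rewrite fI !lee_fin big_split/= sumr_const card_ffun !card_ord mulrDr.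
rewrite -[X in _ -> _ <= _ + _ * X]mulr_natl natrX mulKf// -/(gsum N _).
set G := N%:R ^- d * _ => upper lower.
have lo : G <= I + 2 * B * eta.
  apply: lower => [y|x|x y /close]; rewrite ?addr_ge0 ?sqr_ge0//.
  by rewrite ler_norml => /andP[]; lra.
have up : I <= G + 2 * B * eta.
  apply: upper => [y|x y /close]; rewrite ?sqr_ge0//.
  by rewrite ler_norml => /andP[]; lra.
by rewrite ler_norml; apply/andP; split; lra.
Qed.

(* For a given eta, K makes the averages of level K eta-close to f, and then M
   makes the Riemann sums more precise than the bound for the finest blocks. *)
Lemma net_integral_error n :
  `|I - (b ^ n)%:R^-1 * \sum_(P : 'rV['F_b]_n) f (net_node b D n P) ^+ 2| <=
  net_const b D q r * n.+1%:R ^+ D * rho ^+ n.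
Proof.
have [B B0 fB] := periodic_bounded f fc fper.
(* [X * eta] collects the Riemann error [2 * B * eta] and twice the cost of replacing [f] by its
   averages, once on the grid and once on the net. *)
pose X := 2 * B + 2 * (2 * (B + d%:R) * d%:R).
have X0 : 0 < X by rewrite /X ltr_wpDr ?mulr_gt0// !mulr_ge0// addr_ge0// ltW.
apply/ler_addgt0Pl => e e0.
pose eta := Num.min 1 (e / X).
have eta0 : 0 < eta by rewrite lt_min ltr01 divr_gt0.
have eta1 : eta <= 1 by rewrite ge_min lexx.
have etaX : eta * X <= e by rewrite -ler_pdivlMr// ge_min lexx orbT.
have [delta1 d10 fm1] := periodic_modulus f fc fper eta eta0.
have [K _ Kd] := exists_expn_small b 0 delta1 b1 d10.
have rho0 := rho_gt0 b b_pr r.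
pose eps := rho ^+ (d * K) / 2 ^+ d.
have eps0 : 0 < eps by rewrite divr_gt0 ?exprn_gt0.
have [delta2 d20 fm2] := periodic_modulus f fc fper eps eps0.
have [M] := exists_expn_small b (maxn K n) delta2 b1 d20.
rewrite geq_max => /andP[KM nM] Md2.
have bM0 : (0 < b ^ M)%N by rewrite expn_gt0 (ltnW b1).
have bM0' : 0 < (b ^ M)%:R :> R by rewrite ltr0n.
have Md1 : 2 * pi / (b ^ M)%:R < delta1.
  apply: le_lt_trans Kd; rewrite ler_pM2l ?two_pi_gt0// lef_pV2 ?posrE ?ltr0n ?expn_gt0 ?(ltnW b1)//.
  by rewrite ler_nat leq_exp2l.
pose phi := f \o gridpt (b ^ M).
pose psi := coarse b M K (enum 'I_d) phi.
have psi_close x : `|psi x - phi x| <= d%:R * eta.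
  have -> : d%:R = (size (enum 'I_d))%:R :> R by rewrite size_enum_ord.
  apply: (coarse_close b M b1) => {}x j v vx; apply: ltW; apply: fm1 => k.
  rewrite !mxE /upd; case: eqP => [->|_]; last by rewrite subrr normr0.
  set L := (b ^ (M - K))%N in vx.
  have L0 : (0 < L)%N by rewrite expn_gt0 (ltnW b1).
  have vxL : `|v%:R - (x j)%:R| <= L%:R :> R.
    rewrite (divn_eq v L) (divn_eq (x j) L) vx !natrD opprD addrACA subrr add0r.
    have h1 : (v %% L)%:R <= L%:R :> R by rewrite ler_nat ltnW// ltn_mod.
    have h2 : (x j %% L)%:R <= L%:R :> R by rewrite ler_nat ltnW// ltn_mod.
    have h3 : 0 <= (v %% L)%:R :> R by [].
    have h4 : 0 <= (x j %% L)%:R :> R by [].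
    by rewrite ler_norml; apply/andP; split; lra.
  have -> : node_coord (b ^ M) v - node_coord (b ^ M) (x j) =
      2 * pi / (b ^ M)%:R * (v%:R - (x j)%:R) :> R.
    by rewrite /node_coord mulrAC [X in _ - X]mulrAC -mulrBr.
  have T0 : 0 < 2 * pi / (b ^ M)%:R :> R by rewrite divr_gt0// two_pi_gt0.
  rewrite normrM (gtr0_norm T0); apply: le_lt_trans Kd.
  apply: (@le_trans _ _ (2 * pi / (b ^ M)%:R * L%:R)); first by rewrite ler_pM2l.
  rewrite -mulrA ler_pM2l ?two_pi_gt0// -[X in (b ^ X)%N](subnKC KM) expnD natrM.
  by rewrite invfM -mulrA mulVf ?mulr1// pnatr_eq0 -lt0n.
have sq_close x : `|psi x ^+ 2 - phi x ^+ 2| <= 2 * (B + d%:R) * (d%:R * eta).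
  apply: sqr_close => //.
    have := psi_close x; have := fB (gridpt (b ^ M) x); rewrite -/(phi x) => h1 h2.
    have -> : psi x = psi x - phi x + phi x by rewrite subrK.
    rewrite (le_trans (ler_normD _ _))// addrC lerD// (le_trans h2)//.
    by rewrite ler_piMr.
  by rewrite (le_trans (fB _))// lerDl.
pose E := 2 * (B + d%:R) * (d%:R * eta).
have mean_close (J : finType) (u v : J -> R) (c : R) : c = #|J|%:R -> 0 < c ->
    (forall i, `|u i - v i| <= E) -> `|c^-1 * \sum_i u i - c^-1 * \sum_i v i| <= E.
  move=> cJ c0 uv; rewrite -mulrBr -sumrB normrM gtr0_norm ?invr_gt0//.
  rewrite mulrC ler_pdivrMr// (le_trans (ler_norm_sum _ _ _))//.
  apply: (@le_trans _ _ (\sum_(i : J) E)); first exact: ler_sum.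
  by rewrite sumr_const cJ mulr_natr.
have rie := riemann_sqr_close (b ^ M) B delta1 eta bM0 eta0 Md1 fm1 fB.
have bn0 : 0 < (b ^ n)%:R :> R by rewrite ltr0n expn_gt0 (ltnW b1).
have net := net_err_coarse b D n M K b_pr db nM KM phi q (block_const b D q r) rho (gam b q)
  q2 (block_const_gt0 b D q r) rho0 (gam_ge1 b b_pr q q2) (gam_powR b q q2)
  (rho_gam_lt1 b b_pr q r qr).
have {net} net := net (fun s sK => block_sample_powR_le b D b_pr db q r q2 qr f mf fH K M s
  delta2 eps KM sK eps0 Md2 fm2 _).
have {net} := net _.
rewrite mulrCA divff ?mulr1 ?expf_neq0// => /(_ (lexx _)).
rewrite -/psi -/(net_const b D q r) /net_err.
set g1 := (b ^ M)%:R ^- d * _; set n1 := (b ^ n)%:R^-1 * _ => net.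
set n2 := (b ^ n)%:R^-1 * _; set g2 := (b ^ M)%:R ^- d * _ in rie.
have g12 : `|g1 - g2| <= E.
  apply: mean_close; first by rewrite card_ffun !card_ord -natrX.
    by rewrite exprn_gt0.
  by move=> x; exact: sq_close.
have n12 : `|n1 - n2| <= E.
  apply: mean_close => //; first by rewrite card_net.
  by move=> P; rewrite -(gridpt_net_point _ _ _ M)//; exact: sq_close.
(* From the integral to the grid mean of the squared samples, to that of the squared averages, to
   their net mean, and back to [f] on the net. *)
have -> : I - n2 = (I - g2) - (g1 - g2) + (g1 - n1) + (n1 - n2) by ring.
have tri (x1 x2 x3 x4 : R) : `|x1 - x2 + x3 + x4| <= `|x1| + `|x2| + `|x3| + `|x4|.
  rewrite (le_trans (ler_normD _ _))// lerD2r (le_trans (ler_normD _ _))// lerD2r.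
  exact: ler_normB.
apply: (le_trans (tri _ _ _ _)); move: etaX; rewrite /X => etaX.
move: rie net g12 n12; rewrite /E; move: (`|_|) (`|_|) (`|_|) (`|_|) => z1 z2 z3 z4 *.
nra.
Qed.

End net_integration.

Section all_sizes.
Context {R : realType} (b D : nat) (b_pr : prime b) (db : (D.+1 <= b)%N) (q r : R).
Context (q2 : 2 < q) (qr : q^-1 < r) (r1 : r < 1).
Local Notation d := D.+1.
Local Notation RB := (measurableTypeR R).

Definition smooth_sample (f : 'rV[R]_d -> R) : Prop :=
  [/\ continuous f, torus_periodic f,
    measurable_fun (T := d.-tuple RB) setT (f \o row_of_tuple) &
    forall (e : {set 'I_d}) (t : 'rV[R]_d),
    (\int[torus_measure d]_y (`|iter_difference t (enum e) f (row_of_tuple y)| `^ q)%:E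
     <= ((\prod_(j in e) `|t ord0 j| `^ r) `^ q)%:E)%E].

Let b1 : (1 < b)%N := prime_gt1 b_pr.
Let b0 : 0 < b%:R :> R. Proof. by rewrite ltr0n (ltnW b1). Qed.

Definition shrink : R := (1 - b%:R^-1) `^ (1 - r).

Lemma shrink_lt1 : shrink < 1.
Proof.
have u0 : 0 < 1 - b%:R^-1 :> R by rewrite subr_gt0 invf_lt1// ltr1n.
rewrite /shrink /powR gt_eqF// expR_lt1 pmulr_rlt0 ?subr_gt0//.
by rewrite ln_lt0// u0/= ltrBlDr ltrDl invr_gt0.
Qed.

(** The solution [U] of [net_const + shrink * U = U], which closes the induction over the remaining
    points. *)
Definition union_const : R := net_const b D q r / (1 - shrink).

Lemma net_const_ge0 : 0 <= net_const b D q r.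
Proof.
rewrite /net_const !mulr_ge0 ?exprn_ge0 ?(ltW (block_const_gt0 _ _ _ _))//.
have c0 : 0 <= (1 - rho b r * gam b q)^-1.
  by rewrite invr_ge0 subr_ge0 ltW// rho_gam_lt1.
elim: D => [|D' IH] /=; first by rewrite mulr_ge0 ?addr_ge0 ?exprn_ge0.
by apply: addr_ge0; [apply: mulr_ge0|apply: exprn_ge0]; rewrite ?mulr_ge0 ?addr_ge0 ?exprn_ge0.
Qed.

(* Take the largest net that fits, of size b^k; at most (1 - 1/b) m points are
   left, and r < 1 makes the errors add up geometrically. *)
Lemma exists_union_of_nets (m : nat) : exists xi : seq 'rV[R]_d,
  [/\ size xi = m, (forall x, x \in xi -> torus x) &
   forall f (I : R), smooth_sample f ->
    (\int[torus_measure d]_y ((f (row_of_tuple y)) ^+ 2)%:E = I%:E)%E ->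
    `|m%:R * I - \sum_(x <- xi) f x ^+ 2| <=
    union_const * (trunc_log b m).+1%:R ^+ D * m%:R `^ (1 - r)].
Proof.
have s1 := shrink_lt1; have U0 : 0 <= union_const.
  by rewrite divr_ge0 ?net_const_ge0// subr_ge0 ltW.
elim/ltn_ind: m => -[_|m IH].
  exists [::]; split => // f I _ _.
  by rewrite mul0r big_nil subrr normr0 mulr_ge0 ?powR_ge0// mulr_ge0// exprn_ge0.
set k := trunc_log b m.+1.
have /andP[km mk] := trunc_log_bounds b1 (ltn0Sn m); rewrite -/k in km mk.
have bk0 : (0 < b ^ k)%N by rewrite expn_gt0 (ltnW b1).
have [|xi [sxi txi xiP]] := IH (m.+1 - b ^ k)%N; first by rewrite ltn_subrL bk0.
pose net := [seq net_node b D k P | P <- enum {: 'rV['F_b]_k}] : seq 'rV[R]_d.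
exists (net ++ xi); split.
- by rewrite size_cat size_map -cardE card_net// sxi subnKC.
- move=> x; rewrite mem_cat => /orP[/mapP[P _ ->]|/txi//].
  exact: torus_net_node.
move=> f I fs fI; have {}xiP := xiP f I fs fI; have [fc fper mf fH] := fs.
have netP := net_integral_error b D b_pr db q r q2 qr f fc fper mf fH I fI k.
rewrite big_cat/= big_map big_enum/=.
set S1 := \sum_P _ in netP *; set S2 := \sum_(x <- xi) _ in xiP *.
have bk0' : 0 < (b ^ k)%:R :> R by rewrite ltr0n.
have -> : m.+1%:R * I - (S1 + S2) = (b ^ k)%:R * (I - (b ^ k)%:R^-1 * S1) +
    ((m.+1 - b ^ k)%:R * I - S2).
  by rewrite natrB// mulrBr mulVKf ?gt_eqF//; ring.
rewrite (le_trans (ler_normD _ _))// normrM gtr0_norm//.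
set Y := m.+1%:R `^ (1 - r).
have Y0 : 0 <= Y by exact: powR_ge0.
have head : (b ^ k)%:R * rho b r ^+ k <= Y.
  have -> : (b ^ k)%:R * rho b r ^+ k = (b ^ k)%:R `^ (1 - r).
    rewrite /rho natrX -!powR_mulrn ?powR_ge0 ?(ltW b0)// -!powRrM -powRD; last first.
      by rewrite (gt_eqF b0) implybT.
    by congr powR; ring.
  by rewrite ge0_ler_powR ?nnegrE ?subr_ge0 ?(ltW r1)// ler_nat.
have rest : (m.+1 - b ^ k)%:R `^ (1 - r) <= shrink * Y.
  have u0 : 0 <= 1 - b%:R^-1 :> R by rewrite subr_ge0 invf_le1// ler1n (ltnW b1).
  rewrite /shrink /Y -powRM// ge0_ler_powR ?nnegrE ?subr_ge0 ?(ltW r1) ?mulr_ge0//.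
  rewrite natrB// mulrBl mul1r lerD2l lerN2 mulrC ler_pdivrMr//.
  by rewrite -natrM -expnSr ler_nat ltnW.
set Z : R := k.+1%:R ^+ D.
have Z0 : 0 <= Z by rewrite exprn_ge0.
have netP' : (b ^ k)%:R * `|I - (b ^ k)%:R^-1 * S1| <= net_const b D q r * Z * Y.
  apply: (@le_trans _ _ ((b ^ k)%:R * (net_const b D q r * Z * rho b r ^+ k))).
    by rewrite ler_pM2l.
  by rewrite mulrCA ler_wpM2l// mulr_ge0// net_const_ge0.
have xiP' : `|(m.+1 - b ^ k)%:R * I - S2| <= union_const * Z * (shrink * Y).
  apply: (le_trans xiP); apply: ler_pM => //.
  - by rewrite mulr_ge0// exprn_ge0.
  - rewrite ler_wpM2l// lerXn2r ?nnegrE// ler_nat ltnS.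
    by rewrite leq_trunc_log// leq_subr.
apply: (le_trans (lerD netP' xiP')).
rewrite le_eqVlt; apply/orP; left; apply/eqP.
rewrite /union_const; move: (net_const b D q r) (shrink) s1 => c s s1.
by field; rewrite subr_eq0 gt_eqF.
Qed.

End all_sizes.

(** * From the class to a finite exponent, and the final estimate *)

Section norms.
Context {R : realType} {d : nat}.
Local Notation RB := (measurableTypeR R).
Implicit Types (g : 'rV[R]_d -> R).

(** For [p = +oo], an essential bound [B] also bounds the mean of order [q] because the total mass
    is 1. *)
Lemma Lp_norm_powR_le (p : \bar R) (q B : R) g : p = q%:E \/ p = +oo%E -> 0 < q -> 0 <= B ->
  measurable_fun (T := d.-tuple RB) setT (g \o row_of_tuple) ->
  (Lp_norm p g <= B%:E)%E ->
  (\int[torus_measure d]_y (`|g (row_of_tuple y)| `^ q)%:E <= (B `^ q)%:E)%E.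
Proof.
move=> pq q0 B0 mg.
have mgq : measurable_fun (T := d.-tuple RB) setT (fun y => `|g (row_of_tuple y)| `^ q).
  apply: (measurableT_comp (measurable_powR q)).
  exact: (measurableT_comp (@normr_measurable R setT) mg).
case: pq => ->.
  move=> gB.
  have := @poweR_Lnorm _ _ _ (torus_measure d) (EFin \o (g \o row_of_tuple)) q (negbT (gt_eqF q0)).
  rewrite -/(Lp_norm _ _) => H.
  have -> : (\int[torus_measure d]_y (`|g (row_of_tuple y)| `^ q)%:E =
     Lp_norm q%:E g `^ q)%E by rewrite H.
  rewrite -poweR_EFin gt0_ler_poweR ?(ltW q0)// in_itv/= leey ?andbT ?lee_fin//.
  exact: Lnorm_ge0.
rewrite /Lp_norm unlock => gB.
have mu0 : (0 < torus_measure d [set: d.-tuple RB])%E.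
  by rewrite [X in (_ < X)%E]probability_setT.
rewrite mu0 in gB; have /ess_supP gB' := gB.
apply: (@le_trans _ _ (\int[torus_measure d]_y (B `^ q)%:E)%E).
  apply: ae_ge0_le_integral => //.
  - by have /measurable_EFinP := mgq.
  - by move=> y _; rewrite lee_fin powR_ge0.
  - apply: filterS gB' => y /= + _; rewrite !lee_fin => gy.
    by rewrite ge0_ler_powR ?nnegrE// ltW.
rewrite integral_cst// -[leRHS]mule1 lee_wpmul2l ?lee_fin ?powR_ge0//.
exact: probability_le1.
Qed.

Lemma Lp_norm2_sqr g (B : R) :
  measurable_fun (T := d.-tuple RB) setT (g \o row_of_tuple) ->
  (forall x, `|g x| <= B) -> exists2 I : R,
  (\int[torus_measure d]_y ((g (row_of_tuple y)) ^+ 2)%:E = I%:E)%E &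
  (Lp_norm 2%:E g ^+ 2 = I%:E)%E.
Proof.
move=> mg gB; have B0 : 0 <= B by exact: le_trans (gB 0).
pose J := (\int[torus_measure d]_y ((g (row_of_tuple y)) ^+ 2)%:E)%E.
have J0 : (0 <= J)%E by apply: integral_ge0 => y _; rewrite lee_fin sqr_ge0.
have JB : (J <= (B ^+ 2)%:E)%E.
  apply: (@le_trans _ _ (\int[torus_measure d]_y (B ^+ 2)%:E)%E).
    apply: ge0_le_integral => //.
    - by move=> y _; rewrite lee_fin sqr_ge0.
    - have m2 : measurable_fun (T := d.-tuple RB) setT (fun y => g (row_of_tuple y) ^+ 2).
        exact: (measurable_funX 2 mg).
      by have /measurable_EFinP := m2.
    - by move=> y _; rewrite lee_fin -real_normK ?num_real// lerXn2r ?nnegrE.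
  rewrite integral_cst// -[leRHS]mule1 lee_wpmul2l ?lee_fin ?sqr_ge0//.
  exact: probability_le1.
have Jfin : J \is a fin_num by rewrite ge0_fin_numE// (le_lt_trans JB) ?ltry.
exists (fine J); first by rewrite fineK.
have j0 : 0 <= fine J by exact: fine_ge0.
have JE : (\int[torus_measure d]_y (`|(EFin \o (g \o row_of_tuple)) y| `^ 2) = (fine J)%:E)%E.
  rewrite fineK//; apply: eq_integral => y _ /=.
  by rewrite powR_mulrn// real_normK ?num_real.
rewrite /Lp_norm unlock JE poweR_EFin -EFin_expe -powR_mulrn ?powR_ge0// -powRrM.
by rewrite mulVf ?powRr1// pnatr_eq0.
Qed.

End norms.

Lemma H_cont_smooth_sample {R : realType} D (p : \bar R) (q r : R) (f : 'rV[R]_D.+1 -> R) :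
  p = q%:E \/ p = +oo%E -> 0 < q -> r < 1 -> H_cont r p f -> smooth_sample D q r f.
Proof.
move=> pq q0 r1 [[[fper fL] fH] fc].
have mf : measurable_fun (T := D.+1.-tuple (measurableTypeR R)) setT (f \o row_of_tuple).
  by have := sub_Lfun_mfun fL; rewrite inE.
split => // e t; apply: (Lp_norm_powR_le p) => //.
- by apply: prodr_ge0 => j _; exact: powR_ge0.
- exact: measurable_iter_difference.
- have := fH e t; have -> // : Num.truncn r = 0%N by apply/truncn0Pn; rewrite -ltNge.
Qed.

(** For [p = +oo] the second hypothesis reads [0 < r], and [r^-1 + 2] exceeds both 2 and [r^-1]. *)
Lemma exists_finite_exponent {R : realType} (p : \bar R) (r : R) :
  (2%:E < p)%E -> (p^-1 < r%:E)%E ->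
  exists q : R, [/\ 2 < q, q^-1 < r & p = q%:E \/ p = +oo%E].
Proof.
case: p => [q||//]; rewrite ?lte_fin => p2.
  have q0 : 0 < q by exact: lt_trans p2.
  by rewrite inver gt_eqF// lte_fin => qr; exists q; split => //; left.
move=> r0; exists (r^-1 + 2); split; last by right.
- by rewrite ltrDr invr_gt0.
- by rewrite -[ltRHS]invrK ltf_pV2 ?posrE ?invr_gt0 ?addr_gt0 ?invr_gt0// ltrDl.
Qed.

(** The base [b >= 2] only lowers the logarithm, and the added 1 is at most [ln m / ln 2] since
    [m >= 2]. *)
Lemma trunc_log_succ_le {R : realType} (b m : nat) : (1 < b)%N -> (1 < m)%N ->
  (trunc_log b m).+1%:R <= 2 / ln 2 * ln m%:R :> R.
Proof.
move=> b1 m1; have ln2 : 0 < ln 2 :> R by rewrite ln_gt0// ltr1n.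
have m0 : 0 < m%:R :> R by rewrite ltr0n ltnW.
have lnm : ln 2 <= ln m%:R :> R by rewrite ler_ln ?posrE// ler_nat.
have lnb : ln 2 <= ln b%:R :> R by rewrite ler_ln ?posrE ?ltr0n ?(ltnW b1)// ler_nat.
have kln : (trunc_log b m)%:R * ln 2 <= ln m%:R :> R.
  apply: (@le_trans _ _ ((trunc_log b m)%:R * ln b%:R)); first by rewrite ler_wpM2l.
  rewrite mulr_natl -lnXn ?ltr0n ?(ltnW b1)// -natrX ler_ln ?posrE ?ltr0n ?expn_gt0 ?(ltnW b1) ?(ltnW m1)//.
  by rewrite ler_nat trunc_logP// ltnW.
rewrite mulrAC ler_pdivlMr// -natr1 mulrDl mul1r; lra.
Qed.

Theorem theorem1p3 (R : realType) (d : nat) (p : \bar R) (r : R)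
    (hd : (2 <= d)%N) (hp : (2%:E < p)%E)
    (hpr : (p^-1 < r%:E)%E) (hr : r < 1 / 2) :
  exists C : R, forall m : nat, (2 <= m)%N ->
    (er m (@H_cont R d r p)
      <= (C * m%:R `^ (- r) * ln m%:R `^ (d%:R - 1 + r))%:E)%E.
Proof.
case: d hd => // D _.
have [q [q2 qr pq]] := exists_finite_exponent p r hp hpr.
have q0 : 0 < q by exact: lt_trans q2.
have r0 : 0 < r by apply: lt_trans qr; rewrite invr_gt0.
have r1 : r < 1 by lra.
have [b /ltnW db b_pr] := prime_above D.+1.
have U0 : 0 <= union_const b D q r.
  by rewrite divr_ge0 ?net_const_ge0// subr_ge0 ltW// shrink_lt1.
have ln2 : 0 < ln 2 :> R by rewrite ln_gt0// ltr1n.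
(* [(2 / ln 2) ^+ D] converts the powers of [trunc_log] into powers of [ln m]; the last factor pays
   for the additional [(ln m)^r], which is at least [(ln 2)^r]. *)
exists (union_const b D q r * (2 / ln 2) ^+ D * ln 2 `^ (- r)) => m m2.
have m0 : 0 < m%:R :> R by rewrite ltr0n ltnW.
have lnm : ln 2 <= ln m%:R :> R by rewrite ler_ln ?posrE// ler_nat.
have lnm0 : 0 < ln m%:R :> R by exact: lt_le_trans lnm.
have [xi [sxi txi xiP]] := exists_union_of_nets b D b_pr db q r q2 qr r1 m.
pose node_of (j : 'I_m) := nth 0 xi j.
apply: (@le_trans _ _ (ereal_sup [set discretization_error node_of f | f in H_cont r p])).
  apply: ereal_inf_lbound; exists node_of => // j.
  by apply: txi; rewrite mem_nth// sxi.
apply: ge_ereal_sup => _ [f fH <-].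
have fs := H_cont_smooth_sample D p q r f pq q0 r1 fH.
have [fc fper mf _] := fs.
have [B _ fB] := periodic_bounded f fc fper.
have [I fI fI2] := Lp_norm2_sqr f B mf fB.
rewrite /discretization_error fI2 -EFinB lee_fin.
have -> : \sum_(j < m) `|f (node_of j)| ^+ 2 = \sum_(x <- xi) f x ^+ 2.
  rewrite (big_nth 0) sxi big_mkord; apply: eq_bigr => j _.
  by rewrite real_normK ?num_real.
have -> : I - m%:R^-1 * (\sum_(x <- xi) f x ^+ 2) =
    m%:R^-1 * (m%:R * I - \sum_(x <- xi) f x ^+ 2).
  by rewrite mulrBr mulKf ?gt_eqF.
rewrite normrM gtr0_norm ?invr_gt0// mulrC ler_pdivrMr//.
apply: (le_trans (xiP f I fs fI)).
have -> : m%:R `^ (1 - r) = m%:R `^ (- r) * m%:R.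
  by rewrite addrC powRD ?powRr1 ?(ltW m0)// (gt_eqF m0) implybT.
rewrite mulrA ler_pM2r// [leRHS]mulrAC ler_wpM2r ?powR_ge0//.
have w0 : 0 <= 2 / ln 2 :> R by rewrite divr_ge0// ltW.
have -> : D.+1%:R - 1 + r = D%:R + r :> R by rewrite -natr1 addrK.
rewrite powRD ?(gt_eqF lnm0) ?implybT// powR_mulrn ?(ltW lnm0)//.
apply: (@le_trans _ _ (union_const b D q r * ((2 / ln 2) ^+ D * ln m%:R ^+ D))).
  rewrite ler_wpM2l// -exprMn lerXn2r ?nnegrE//; first by rewrite mulr_ge0// ltW.
  exact: (trunc_log_succ_le _ _ (prime_gt1 b_pr) m2).
move: (2 / ln 2) w0 => w w0; move: (union_const b D q r) U0 => U U0.
rewrite -!(mulrA U) ler_wpM2l// -mulrA ler_wpM2l ?exprn_ge0//.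
rewrite mulrCA ler_peMr ?exprn_ge0 ?(ltW lnm0)//.
rewrite powRN mulrC ler_pdivlMr ?powR_gt0// mul1r.
by rewrite ge0_ler_powR ?nnegrE ?(ltW r0) ?(ltW ln2) ?(ltW lnm0).
Qed.
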